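(* Let $\Phi$ denote the standard normal CDF and let $\eta_0 := 2\left(1-\Phi(\sqrt{2\log 2})\right)\approx 0.239$. Let $\epsilon>0$ and $\eta<\eta_0-\epsilon$, and let $X\in\mathbb{R}^{m\times n}$ have i.i.d. $N(0,1)$ entries with $m> C\frac{n}{\epsilon^2}$ for a sufficiently large absolute constant $C$. Then with probability $1-e^{-\Omega(\epsilon^2 m)}$ the matrix $X$ has the following property: for any $w^*\in\mathbb{R}^n$, any $\zeta\in\mathbb{R}^m$ with $\|\zeta\|_0\leq\eta m$, any $d\in\mathbb{R}^m$, and $y=Xw^*+d+\zeta$, the estimator \[ \widehat{w} := \operatorname{argmin}_{w\in\mathbb{R}^n}\|y-Xw\|_1 \] satisfies \[ \|\widehat{w}-w^*\|_2 \leq O\left(\frac{\|d\|_1}{\epsilon m}\right), \] where the constant in $O(\cdot)$ is absolute.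
   Context: $\|\zeta\|_0$ denotes the number of nonzero entries of $\zeta$. The vector $\zeta$ represents adversarial sparse corruptions and $d$ is arbitrary dense noise. *)

(* Defs.v *)
From HB Require Import structures.
From mathcomp Require Import all_boot all_order all_algebra.
From mathcomp Require Import all_classical all_reals all_analysis.
Set Implicit Arguments. Unset Strict Implicit. Unset Printing Implicit Defensive.
Import Order.TTheory GRing.Theory Num.Theory.
Local Open Scope classical_set_scope.
Local Open Scope ring_scope.

Definition Phi {R : realType} (x : R) : R :=
  fine (normal_prob (0:R) 1 `]-oo, x]).

Definition eta0 {R : realType} : R :=
  2 * (1 - Phi (Num.sqrt (2 * ln 2))).

Definition l1norm {R : realType} {k : nat} (v : 'cV[R]_k) : R :=
  \sum_(i < k) `|v i 0|.
Definition l2norm {R : realType} {k : nat} (v : 'cV[R]_k) : R :=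
  Num.sqrt (\sum_(i < k) v i 0 ^+ 2).
Definition l0norm {R : realType} {k : nat} (v : 'cV[R]_k) : nat :=
  #|[set i : 'I_k | v i 0 != 0]|.

Definition is_l1_argmin {R : realType} {m n : nat}
    (A : 'M[R]_(m, n)) (y : 'cV[R]_m) (w : 'cV[R]_n) : Prop :=
  forall w' : 'cV[R]_n, l1norm (y - A *m w) <= l1norm (y - A *m w').

Definition robust_l1_property {R : realType} {m n : nat}
    (A : 'M[R]_(m, n)) (eta eps K : R) : Prop :=
  forall (wstar : 'cV[R]_n) (zeta dv : 'cV[R]_m),
    (l0norm zeta)%:R <= eta * m%:R ->
    forall what : 'cV[R]_n,
      is_l1_argmin A (A *m wstar + dv + zeta) what ->
      l2norm (what - wstar) <= K * l1norm dv / (eps * m%:R).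

(* The random variables X i j (i < m, j < n) are i.i.d. N(0,1):
   each has law N(0,1), and they are mutually independent
   (product rule for every choice of Borel sets; taking some sets equal
    to setT yields the product rule for every subfamily). *)
Definition iid_std_normal_matrix {d : measure_display} {T : measurableType d}
    {R : realType} (P : probability T R) {m n : nat}
    (X : 'I_m -> 'I_n -> {RV P >-> R}) : Prop :=
  (forall i j (B : set R), measurable B ->
      P (X i j @^-1` B) = normal_prob (0:R) 1 B) /\
  (forall B : 'I_m -> 'I_n -> set R, (forall i j, measurable (B i j)) ->
      P [set t | forall i j, B i j (X i j t)] =
      (\prod_(i < m) \prod_(j < n) P (X i j @^-1` B i j))%E).

(* Main.v *)
Require Import Defs.
From HB Require Import structures.
From mathcomp Require Import all_boot all_order all_algebra.
From mathcomp Require Import all_classical all_reals all_analysis.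
From mathcomp Require Import measurable_realfun ring lra.
Import Order.TTheory GRing.Theory Num.Theory.
Import numFieldNormedType.Exports.
Local Open Scope classical_set_scope.
Local Open Scope ring_scope.

(* Put t = sqrt(2 log 2) and clip(x) = min(|x|, 2t - |x|), a 1-Lipschitz function
   with clip(0) = 0. If S has at most eta m elements, the sum of |g_i| over the
   complement of S minus the sum over S is at least sum_i clip(g_i) - 2 t eta m,
   and E clip(N(0,1)) = 2 t eta0 exactly, because the density at t is half the
   density at 0. So it suffices that sum_i clip(<X_i, u>) >= m (2 t eta0 - t eps)
   uniformly over unit vectors u; optimality of the l1 minimiser does the rest.

   The uniform bound loses no logarithm because it comes from one exponential
   moment: by Jensen and the Ledoux-Talagrand contraction principle, applied row
   by row, E exp(lam max_u sum_i (E clip - clip <X_i, u>)) is at most the largest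
   E exp(2 lam max_u sum_i s_i <X_i, u>) over signs s_i, and the latter is bounded by
   exp(4 lam^2 m) 2^(n/2), since 2 lam <G, u> <= 4 lam^2 m + |G|^2 / (4m) for the
   Gaussian vector G = sum_i s_i X_i. Chernoff's bound with lam = eps / 8 concludes.
   Maxima are over finitely many of the normalised rational vectors. *)

Set Implicit Arguments.
Unset Strict Implicit.
Unset Printing Implicit Defensive.

(** * Gaussian integrals on the line *)

Section gaussian.
Context {R : realType}.
Local Notation mu := (@lebesgue_measure R).
Local Notation pdf := (@normal_pdf R).
Local Notation N01 := (normal_prob (0 : R) 1).

(** The Radon-Nikodym derivative of the normal law is [pdf a s] only almost everywhere, since both
    have the same integral over every measurable set; the change of variables passes along this a.e.
    equality. *)
Lemma ge0_integral_normal_prob (a s : R) (f : R -> \bar R) :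
  measurable_fun [set: R] f -> (forall x, 0 <= f x)%E ->
  (\int[normal_prob a s]_x f x = \int[mu]_x (f x * (pdf a s x)%:E))%E.
Proof.
move=> mf f0.
have dom := @normal_prob_dominates R a s.
rewrite -(Radon_Nikodym_SigmaFinite.change_of_variables dom)//.
apply: ae_eq_integral => //.
- apply: emeasurable_funM => //.
  exact: measurable_int (Radon_Nikodym_SigmaFinite.f_integrable dom).
- apply: emeasurable_funM => //.
  by apply/measurable_EFinP; exact: measurable_normal_pdf.
- apply: ae_eqe_mul2l; apply: integral_ae_eq => //.
  + exact: Radon_Nikodym_SigmaFinite.f_integrable.
  + by apply/measurable_EFinP; exact: measurable_normal_pdf.
  + by move=> E _ mE; rewrite -Radon_Nikodym_SigmaFinite.f_integral.
Qed.

Lemma normal_pdf01N (x : R) : pdf 0 1 (- x) = pdf 0 1 x.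
Proof. by rewrite !normal_pdfE ?oner_neq0// /normal_fun !subr0 sqrrN. Qed.

Lemma ge0_integral_normal01N (f : R -> \bar R) :
  measurable_fun [set: R] f -> (forall x, 0 <= f x)%E ->
  (\int[N01]_x f (- x)%R = \int[N01]_x f x)%E.
Proof.
move=> mf f0.
rewrite !ge0_integral_normal_prob//; last exact: measurableT_comp.
under eq_integral do rewrite -normal_pdf01N.
pose g x := (f x * (pdf 0 1 x)%:E)%E.
have mg : measurable_fun [set: R] g.
  apply: emeasurable_funM => //.
  by apply/measurable_EFinP; exact: measurable_normal_pdf.
have g0 x : (0 <= g x)%E by rewrite mule_ge0// lee_fin normal_pdf_ge0.
transitivity (\int[pushforward mu (-%R : R -> measurableTypeR R)]_x g x)%E.
  by rewrite ge0_integral_pushforward.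
by apply: eq_measure_integral => //= A mA _; exact: lebesgue_measureN.
Qed.

Lemma ge0_integral_affine (G : R -> R) (k b : R) : 0 < k ->
  continuous G -> (forall x, 0 <= G x) ->
  (\int[mu]_x (G x)%:E = \int[mu]_x (G (k * x + b) * k)%:E)%E.
Proof.
move=> k0 cG G0.
(* The map k x + b is written as a shift followed by a scaling, so that its limits at both
   infinities can be read off. *)
pose F : R -> R := fun x => (x + b / k) * k.
have FE x : F x = k * x + b by rewrite /F mulrDl divfK ?gt_eqF// mulrC.
have dF (x : R) : is_derive x 1 F k.
  rewrite /F; apply: is_derive_eq.
  by rewrite /GRing.scale/= mulr0 add0r addr0 mulr1.
have F'E : derive1 F = cst k.
  by apply/funext => x; rewrite derive1E; exact: derive_val.
rewrite (@increasing_ge0_integration_by_substitutionT _ F G)//.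
- by apply: eq_integral => x _; rewrite F'E -FE.
- by move=> x y xy; rewrite !FE ltrD2r ltr_pM2l.
- by rewrite F'E => x; exact: cvg_cst.
- by rewrite F'E; exact: is_cvg_cst.
- by rewrite F'E; exact: is_cvg_cst.
- by apply/gt0_cvgMlNy => //; exact: cvg_addrr_Ny.
- by apply/gt0_cvgMly => //; exact: cvg_addrr.
Qed.

Lemma ge0_integral_normal01_affine (h : R -> R) (s b : R) : 0 < s ->
  continuous h -> (forall x, 0 <= h x) ->
  (\int[N01]_y (h (s * y + b)%R)%:E = \int[mu]_z (h z * pdf b s z)%:E)%E.
Proof.
move=> s0 ch h0.
have ch' : continuous (fun y => h (s * y + b)).
  move=> y; apply: continuous_comp; last exact: ch.
  by apply: cvgD; [apply: cvgMr; exact: cvg_id|exact: cvg_cst].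
rewrite (@ge0_integral_normal_prob 0 1 (fun y => (h (s * y + b))%:E)); first last.
- by move=> y; rewrite lee_fin.
- by apply/measurable_EFinP; exact: continuous_measurable_fun.
rewrite [RHS](@ge0_integral_affine _ s b)//; first last.
- by move=> x; rewrite mulr_ge0// normal_pdf_ge0.
- by move=> z; apply: cvgM; [exact: ch|exact/continuous_normal_pdf/lt0r_neq0].
apply: eq_integral => y _; rewrite -EFinM -mulrA; congr (_ * _)%:E.
rewrite !normal_pdfE ?oner_neq0 ?gt_eqF// mulrAC; congr (_ * _).
  rewrite /normal_peak expr1n mul1r -mulrnAr sqrtrM ?sqr_ge0// sqrtr_sqr gtr0_norm//.
  by rewrite invfM mulrAC mulVf ?mul1r// gt_eqF.
rewrite /normal_fun addrK subr0 expr1n exprMn; congr expR.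
by rewrite mulNr -mulrnAr invfM; field; rewrite gt_eqF.
Qed.

(* Completing the square: the law of x ~ N(0,1) and z | x ~ N(a x, s^2), read
   backwards as z ~ N(0, s^2 + a^2) and x | z ~ N(a z / r^2, s^2 / r^2). *)
Lemma normal_pdf_square (a s x z : R) (r := Num.sqrt (s ^+ 2 + a ^+ 2)) : 0 < s ->
  pdf 0 1 x * pdf (a * x) s z = pdf 0 r z * pdf (a * z / r ^+ 2) (s / r) x.
Proof.
move=> s0.
have r2 : r ^+ 2 = s ^+ 2 + a ^+ 2.
  by rewrite sqr_sqrtr// addr_ge0// sqr_ge0.
have q0 : 0 < s ^+ 2 + a ^+ 2 by rewrite ltr_wpDr ?sqr_ge0// exprn_gt0.
have r0 : 0 < r by rewrite sqrtr_gt0.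
rewrite !normal_pdfE ?oner_neq0 ?gt_eqF ?divr_gt0//.
rewrite mulrACA [RHS]mulrACA; congr (_ * _).
  rewrite /normal_peak -!invfM -!sqrtrM; last 2 first.
  - by rewrite pmulrn_lge0// mulr_ge0 ?pi_ge0// sqr_ge0.
  - by rewrite pmulrn_lge0// mulr_ge0 ?pi_ge0// sqr_ge0.
  congr (Num.sqrt _)^-1; rewrite expr_div_n r2 !mulr2n; field.
  by rewrite gt_eqF.
rewrite /normal_fun -!expRD; congr expR.
rewrite r2 expr_div_n r2 !mulr2n; field.
by rewrite !gt_eqF// addr_gt0// exprn_gt0.
Qed.

(** For s > 0 and fixed x, a x + s y has density [pdf (a * x) s]. After Tonelli, [normal_pdf_square]
    factors the joint density into that of N(0, r^2) at z times a probability density in x, which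
    integrates to 1. The case s = 0 is included because s will be the norm of a possibly zero
    coefficient vector. *)
Lemma integral_normal01_rotation (h : R -> R) (s a : R) : 0 <= s ->
  continuous h -> (forall x, 0 <= h x) ->
  (\int[N01]_x \int[N01]_y (h (a * x + s * y)%R)%:E =
   \int[N01]_z (h (Num.sqrt (s ^+ 2 + a ^+ 2) * z)%R)%:E)%E.
Proof.
move=> s0 ch h0.
have chM (c : R) : continuous (fun x => h (c * x)).
  move=> y; apply: continuous_comp; last exact: ch.
  by apply: cvgMr; exact: cvg_id.
move: s0; rewrite le_eqVlt => /predU1P[<-|s0].
  under eq_integral => x _.
    under eq_integral do rewrite mul0r addr0.
    rewrite integral_cst// [X in (_ * X)%E]probability_setT mule1; over.
  (* The square root is now |a|; a negative a is absorbed by the symmetry of N(0,1). *)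
  rewrite expr0n/= add0r sqrtr_sqr.
  have [a0|a0] := ger0P a; first by [].
  rewrite -[RHS]ge0_integral_normal01N//.
  - by under [RHS]eq_integral do rewrite mulrNN.
  - by apply/measurable_EFinP; apply: continuous_measurable_fun; exact: chM.
  - by move=> x; rewrite lee_fin.
set r := Num.sqrt _.
have r0 : 0 < r.
  by rewrite sqrtr_gt0 ltr_wpDr ?sqr_ge0// exprn_gt0.
have mpdf (b c : R) : measurable_fun [set: R] (pdf b c).
  exact: measurable_normal_pdf.
have mh : measurable_fun [set: R] h by exact: continuous_measurable_fun.
have mg : measurable_fun [set: R * R]
    (fun xz => (h xz.2 * pdf (a * xz.1) s xz.2)%:E).
  apply/measurable_EFinP/measurable_funM; first exact: measurableT_comp.
  under eq_fun do rewrite normal_pdfE ?gt_eqF// /normal_fun.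
  apply: measurable_funM => //.
  apply: measurableT_comp => //; apply: measurable_funM => //.
  apply: measurableT_comp => //; apply: measurable_funX.
  by apply: measurable_funB => //; apply: measurable_funM.
under eq_integral => x _.
  under eq_integral do rewrite addrC.
  rewrite ge0_integral_normal01_affine//; over.
rewrite [LHS](@ge0_integral_normal_prob 0 1
  (fun x => \int[mu]_z (h z * pdf (a * x) s z)%:E)%E); first last.
- move=> x; apply: integral_ge0 => z _.
  by rewrite lee_fin mulr_ge0// normal_pdf_ge0.
- have H : forall x : R * R, (0 <= (h x.2 * pdf (a * x.1) s x.2)%:E)%E.
    by move=> x; rewrite lee_fin mulr_ge0// normal_pdf_ge0.
  have H2 := @measurable_fun_fubini_tonelli_F _ _ _ _ R mu _ mg H.
  exact: H2.
transitivity (\int[mu]_x \int[mu]_z (pdf 0 1 x * (h z * pdf (a * x) s z))%:E)%E.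
  apply: eq_integral => x _; rewrite muleC -ge0_integralZl//.
  - by apply/measurable_EFinP/measurable_funM; [exact: mh|exact: mpdf].
  - by move=> z _; rewrite lee_fin mulr_ge0// normal_pdf_ge0.
  - by rewrite lee_fin normal_pdf_ge0.
have mg' : measurable_fun [set: R * R]
    (fun xz => (pdf 0 1 xz.1 * (h xz.2 * pdf (a * xz.1) s xz.2))%:E).
  apply/measurable_EFinP/measurable_funM; first exact: measurableT_comp.
  exact/measurable_EFinP.
have g'0 (x : R * R) : (0 <= (pdf 0 1 x.1 * (h x.2 * pdf (a * x.1) s x.2))%:E)%E.
  by rewrite lee_fin !mulr_ge0// normal_pdf_ge0.
rewrite [LHS](@fubini_tonelli _ _ _ _ R mu mu _ mg' g'0)/=.
transitivity (\int[mu]_z (h z * pdf 0 r z)%:E)%E; last first.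
  under [RHS]eq_integral do rewrite -[X in h X]addr0.
  by rewrite ge0_integral_normal01_affine.
apply: eq_integral => z _.
under eq_integral => x _ do
  rewrite mulrCA normal_pdf_square// mulrA EFinM.
rewrite ge0_integralZl//.
- by rewrite integral_normal_pdf mule1.
- by apply/measurable_EFinP; exact: mpdf.
- by move=> x _; rewrite lee_fin normal_pdf_ge0.
- by rewrite lee_fin mulr_ge0// normal_pdf_ge0.
Qed.

(** Multiplying the N(0,1) density by exp(z^2/4) leaves exp(-z^2/4), which is sqrt 2 times the
    density of N(0,2). *)
Lemma integral_normal01_expR_sqr :
  (\int[N01]_z (expR (z ^+ 2 / 4))%:E = (Num.sqrt 2)%:E)%E.
Proof.
rewrite (@ge0_integral_normal_prob 0 1 (fun z => (expR (z ^+ 2 / 4))%:E)); first last.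
- by move=> z; rewrite lee_fin expR_ge0.
- by apply/measurable_EFinP; apply: measurableT_comp => //; exact: measurable_funM.
have s2 : 0 < Num.sqrt (2 : R) by rewrite sqrtr_gt0.
transitivity (\int[mu]_z ((Num.sqrt 2)%:E * (pdf 0 (Num.sqrt 2) z)%:E))%E.
  apply: eq_integral => z _; rewrite -!EFinM; congr EFin.
  rewrite !normal_pdfE ?oner_neq0 ?gt_eqF// mulrCA [RHS]mulrA; congr (_ * _).
    rewrite /normal_peak expr1n mul1r -mulrnAr sqrtrM ?sqr_ge0// sqrtr_sqr.
    by rewrite gtr0_norm// invfM mulrA mulfV ?mul1r// gt_eqF.
  rewrite /normal_fun -expRD; congr expR.
  by rewrite subr0 sqr_sqrtr// expr1n !mulr2n; field.
rewrite ge0_integralZl//.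
- by rewrite integral_normal_pdf mule1.
- by apply/measurable_EFinP; exact: measurable_normal_pdf.
- by move=> x _; rewrite lee_fin normal_pdf_ge0.
Qed.

Lemma Phi_compl (t : R) : (\int[mu]_(x in `[t, +oo[) (pdf 0 1 x)%:E = (1 - Phi t)%:E)%E.
Proof.
have e : N01 `]t, +oo[ = N01 `[t, +oo[.
  rewrite /normal_prob integral_itv_obnd_cbnd//.
  by apply/measurable_EFinP/measurable_funTS; exact: measurable_normal_pdf.
rewrite -[LHS]/(N01 `[t, +oo[) -e /Phi EFinB fineK; last exact: fin_num_measure.
have <- : ~` `]-oo, t]%classic = `]t, +oo[%classic by rewrite setCitvl.
by rewrite probability_setC.
Qed.

(** An antiderivative of x [pdf 0 1 x] is - [pdf 0 1 x], which vanishes at infinity. *)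
Lemma integral_normal_pdf_id (t : R) : 0 <= t ->
  (\int[mu]_(x in `[t, +oo[) (x * pdf 0 1 x)%:E = (pdf 0 1 t)%:E)%E.
Proof.
move=> t0.
have dF (x : R) : is_derive x 1 (fun x => - pdf 0 1 x) (x * pdf 0 1 x).
  rewrite normal_pdfE ?oner_neq0// /normal_fun.
  apply: is_derive_eq; rewrite /GRing.scale/= !(subr0, addr0, oppr0, mulr1, mulr0, expr1n) !mulr2n.
  by field.
have cpdf : continuous (pdf 0 1 : R -> R) by exact: continuous_normal_pdf.
rewrite (@ge0_continuous_FTC2y _ _ (fun x => - pdf 0 1 x) t 0).
- by rewrite -EFinB sub0r opprK.
- by move=> x tx; rewrite mulr_ge0 ?normal_pdf_ge0// (le_trans t0).
- apply: continuous_subspaceT => x; apply: cvgM; [exact: cvg_id|exact: cpdf].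
- rewrite -[X in _ --> X]oppr0; apply: cvgN.
  have -> : pdf 0 1 = fun x : R => normal_peak 1 * expR (- (x ^+ 2 / (1 ^+ 2 *+ 2))).
    by apply/funext => x; rewrite normal_pdfE ?oner_neq0// /normal_fun subr0 mulNr.
  rewrite -[X in _ --> X](mulr0 (normal_peak 1)); apply: cvgMr.
  apply: (cvg_comp (fun x : R => x ^+ 2 / (1 ^+ 2 *+ 2)) (fun x => expR (- x))).
    by apply: gt0_cvgMly; [rewrite invr_gt0 expr1n|exact: cvgr_expr2].
  exact: cvgr_expR.
- by move=> x _; exact: @ex_derive.
- by apply: cvgN; apply: cvg_at_right_filter; exact: cpdf.
- by move=> x _; rewrite derive1E; exact: derive_val.
Qed.

(** For t >= 0 at most one of x - t and - x - t is positive, so the excess of |x| is a sum of two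
    one-sided excesses with equal means by symmetry. Each mean is the tail integral of x minus t
    times the tail mass. *)
Lemma integral_normal01_excess (t : R) : 0 <= t ->
  (\int[N01]_x (Num.max (`|x| - t) 0)%:E = (2 * (pdf 0 1 t - t * (1 - Phi t)))%:E)%E.
Proof.
move=> t0.
have mpdf (D : set R) : measurable_fun D (pdf 0 1).
  by apply: measurable_funTS; exact: measurable_normal_pdf.
have mm : measurable_fun [set: R] (fun x => Num.max (x - t) 0).
  by apply: measurable_maxr => //; exact: measurable_funB.
have one : (\int[N01]_x (Num.max (x - t) 0)%:E = (pdf 0 1 t - t * (1 - Phi t))%:E)%E.
  rewrite (@ge0_integral_normal_prob 0 1 (fun x => (Num.max (x - t) 0)%:E)); first last.
  - by move=> x; rewrite lee_fin le_max lexx orbT.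
  - exact/measurable_EFinP.
  transitivity (\int[mu]_(x in `[t, +oo[) ((x - t) * pdf 0 1 x)%:E)%E.
    rewrite [RHS]integral_mkcond; apply: eq_integral => x _.
    rewrite patchE mem_setE in_itv/= andbT; case: ifPn => tx.
      by rewrite max_l ?subr_ge0.
    by rewrite max_r ?mul0e// subr_le0 ltW// ltNge.
  have := integral_normal_pdf_id t0.
  (* Splitting x as (x - t) + t keeps both summands nonnegative on the tail; the wanted integral is
     then found by cancellation. *)
  under eq_integral do rewrite -[X in X * _](subrK t) mulrDl EFinD.
  rewrite ge0_integralD//; first last.
  - by apply/measurable_EFinP/measurable_funM => //; exact: mpdf.
  - by move=> x _; rewrite lee_fin mulr_ge0// normal_pdf_ge0.
  - by apply/measurable_EFinP/measurable_funM; [exact: measurable_funB|exact: mpdf].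
  - move=> x; rewrite /= in_itv/= andbT => tx.
    by rewrite lee_fin mulr_ge0// ?subr_ge0// normal_pdf_ge0.
  under [X in (_ + X)%E]eq_integral do rewrite EFinM.
  rewrite ge0_integralZl//; first last.
  - by move=> x _; rewrite lee_fin normal_pdf_ge0.
  - by apply/measurable_EFinP; exact: mpdf.
  rewrite Phi_compl -EFinM => e; rewrite EFinB -e addeK//.
transitivity (\int[N01]_x ((Num.max (x - t) 0)%:E + (Num.max (- x - t) 0)%:E))%E.
  apply: eq_integral => x _; rewrite -EFinD; congr EFin.
  have [x0|x0] := lerP 0 x.
    by rewrite ger0_norm// (@max_r _ _ (- x - t)) ?addr0//; lra.
  by rewrite ltr0_norm// (@max_r _ _ (x - t)) ?add0r//; lra.
rewrite ge0_integralD//; first last.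
- apply/measurable_EFinP; apply: measurable_maxr => //.
  by apply: measurable_funB => //; exact: measurable_oppr.
- by move=> x _; rewrite lee_fin le_max lexx orbT.
- exact/measurable_EFinP.
- by move=> x _; rewrite lee_fin le_max lexx orbT.
rewrite (@ge0_integral_normal01N (fun x => (Num.max (x - t) 0)%:E)); first last.
- by move=> x; rewrite lee_fin le_max lexx orbT.
- exact/measurable_EFinP.
by rewrite one -EFinD; congr EFin; ring.
Qed.

End gaussian.

(** * Independence of sub-families *)

Section independence.
Context {d : measure_display} {T : measurableType d} {R : realType}.
Variables (P : probability T R) (I : finType) (W : I -> {RV P >-> R}).

(** A pi-system generating the sigma-algebra of the variables [W i] with [J i]. Putting [setT]
    outside [J] lets all subfamilies share the index type [I]. *)
Definition rectangles (J : pred I) : set (set T) :=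
  [set E | exists B : I -> set R, [/\ forall i, measurable (B i),
     forall i, ~~ J i -> B i = setT & E = [set t | forall i, B i (W i t)]]].

Definition mutual_indep := forall B : I -> set R, (forall i, measurable (B i)) ->
  P [set t | forall i, B i (W i t)] = (\prod_i P (W i @^-1` B i))%E.

Local Notation TJ J := (g_sigma_algebraType (rectangles J)).

Lemma rectanglesI (J : pred I) : setI_closed (rectangles J).
Proof.
move=> _ _ [B [mB BJ ->]] [C [mC CJ ->]].
exists (fun i => B i `&` C i); split=> [i|i iJ|].
- exact: measurableI.
- by rewrite BJ// CJ// setIT.
- by apply/seteqP; split=> t; [move=> [Bt Ct] i|move=> BC; split=> i; have [] := BC i].
Qed.

Lemma measurable_rectangles (J : pred I) : rectangles J `<=` measurable.
Proof.
move=> _ [B [mB _ ->]].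
have -> : [set t | forall i, B i (W i t)] = \bigcap_(i in [set: I]) (W i @^-1` B i).
  by apply/seteqP; split=> t H i => [_|]; exact: H.
apply: fin_bigcap_measurable => // i _.
by rewrite -[_ @^-1` _]setTI; exact: measurable_funP.
Qed.

Lemma sigma_rectangles_measurable (J : pred I) (A : set T) :
  <<s rectangles J >> A -> measurable A.
Proof.
by apply: smallest_sub; [exact: sigma_algebra_measurable|exact: measurable_rectangles].
Qed.

Lemma rectanglesT (J : pred I) : rectangles J setT.
Proof.
by exists (fun=> setT); split=> //; apply/seteqP; split.
Qed.

Lemma measurable_sub_RV (J : pred I) (i : I) : J i ->
  measurable_fun [set: TJ J] (W i).
Proof.
move=> iJ _ B mB; rewrite setTI; apply: sub_sigma_algebra.
exists (fun j => if j == i then B else setT); split=> [j|j jJ|].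
- by case: ifP.
- by case: ifPn jJ => // /eqP ->; rewrite iJ.
- apply/seteqP; split => t /=; first by move=> Bt j; case: ifPn => // /eqP ->.
  by move=> /(_ i); rewrite eqxx.
Qed.

Section fubini.
Hypothesis iW : mutual_indep.

(** At each index one of the two constraints is [setT], so the two products over [I] combine factor
    by factor. *)
Lemma indep_rectangles (J K : pred I) (A B : set T) : (forall i, J i -> ~~ K i) ->
  rectangles J A -> rectangles K B -> P (A `&` B) = (P A * P B)%E.
Proof.
move=> JK [A' [mA AJ ->]] [B' [mB BK ->]].
have -> : [set t | forall i, A' i (W i t)] `&` [set t | forall i, B' i (W i t)] =
    [set t | forall i, (A' i `&` B' i) (W i t)].
  by apply/seteqP; split=> t; [move=> [At Bt] i|move=> AB; split=> i; have [] := AB i].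
have mAB i : measurable (A' i `&` B' i) by exact: measurableI.
rewrite (iW mA) (iW mB) (iW mAB).
rewrite -big_split/=; apply: eq_bigr => i _.
have [iJ|iJ] := boolP (J i).
  by rewrite (BK i (JK i iJ)) setIT preimage_setT probability_setT mule1.
by rewrite (AJ i)// setTI preimage_setT probability_setT mul1e.
Qed.

(** Two passes of uniqueness of measures: for fixed D, the finite measures C |-> P(C & D) and C |->
    P(D) P(C) agree on a pi-system, hence on the sigma-algebra it generates. One pass extends the
    first event, the other the second. *)
Lemma indep_sigma_rectangles (J K : pred I) (A B : set T) : (forall i, J i -> ~~ K i) ->
  <<s rectangles J >> A -> <<s rectangles K >> B -> P (A `&` B) = (P A * P B)%E.
Proof.
move=> JK sA sB.
have key (C D : set T) (L : pred I) : measurable D ->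
    (forall E, rectangles L E -> P (E `&` D) = P E * P D)%E ->
    <<s rectangles L >> C -> P (C `&` D) = (P C * P D)%E.
  move=> mD H sC.
  have D0 : 0 <= fine (P D) by rewrite fine_ge0.
  have DE : P D = (fine (P D))%:E by rewrite fineK// fin_num_measure.
  have e : mrestr P mD C = mscale (NngNum D0) P C.
    apply: (@g_sigma_algebra_measure_unique _ R T (rectangles L)
      (@measurable_rectangles L) (fun=> setT) (fun=> @rectanglesT L) _
      (mrestr P mD) (mscale (NngNum D0) P) (@rectanglesI L) _ _ _ sC).
    - by rewrite bigcup_const//; exists 0%N.
    - by move=> E rE; rewrite /= /mrestr /mscale/= H// DE muleC.
    - by move=> _; rewrite /= /mrestr setTI -ge0_fin_numE// fin_num_measure.
  by move: e; rewrite /mrestr /mscale/= -DE => ->; rewrite muleC.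
have mB := sigma_rectangles_measurable sB.
apply: (key _ _ J) => // E rE.
rewrite setIC muleC; apply: (key _ _ K) => //; first exact: measurable_rectangles rE.
by move=> F rF; rewrite setIC muleC; exact: (@indep_rectangles J K).
Qed.

(** Independence as decoupling: the first argument of [F] sees only the variables in [J], the second
    only those in [K]. The law of the diagonal t |-> (t, t) for these two sigma-algebras is
    therefore the product of its marginals, and Tonelli applies. *)
Lemma indep_fubini (J K : pred I) (F : TJ J * TJ K -> \bar R) :
  (forall i, J i -> ~~ K i) -> measurable_fun setT F -> (forall x, 0 <= F x)%E ->
  (\int[P]_t F (t, t) = \int[P]_t \int[P]_t' F (t, t'))%E.
Proof.
move=> JK mF F0.
have mid (L : pred I) : measurable_fun [set: T] (id : T -> TJ L).
  by move=> _ B sB; rewrite setTI; exact: sigma_rectangles_measurable sB.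
pose idm (L : pred I) : {mfun T >-> TJ L} := HB.pack (id : T -> TJ L)
   (isMeasurableFun.Build _ _ _ _ (id : T -> TJ L) (mid L)).
pose PJ L : probability (TJ L) R := distribution P (idm L).
pose g : T -> (TJ J * TJ K)%type := fun t => (t, t).
have mdiag : measurable_fun [set: T] g.
  by apply: measurable_fun_pair; exact: mid.
pose dg : {mfun T >-> (TJ J * TJ K)%type} := HB.pack g
   (isMeasurableFun.Build _ _ T (TJ J * TJ K)%type g mdiag).
transitivity (\int[distribution P dg]_z F z)%E.
  by rewrite ge0_integral_distribution.
transitivity (\int[PJ J \x PJ K]_z F z)%E.
  apply: eq_measure_integral => A mA _; apply/esym/product_measure_unique => //.
  move=> B C mB mC; rewrite /distribution /pushforward/=.
  exact: (@indep_sigma_rectangles J K).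
rewrite fubini_tonelli1//= /fubini_F.
rewrite ge0_integral_distribution//=; first last.
- by move=> x; apply: integral_ge0.
- exact: measurable_fun_fubini_tonelli_F.
apply: eq_integral => t _; rewrite ge0_integral_distribution//=.
exact: measurableT_comp.
Qed.

End fubini.
End independence.

(** * Linear combinations of independent Gaussians *)

Lemma measurable_sum_in (d : measure_display) (T : measurableType d) (R : realType)
    (I : eqType) (r : seq I) (f : I -> T -> R) :
  (forall i, i \in r -> measurable_fun [set: T] (f i)) ->
  measurable_fun [set: T] (fun t => \sum_(i <- r) f i t).
Proof.
elim: r => [_|i r IH H].
  by under eq_fun do rewrite big_nil; exact: measurable_cst.
under eq_fun do rewrite big_cons.
apply: measurable_funD; first by apply: H; rewrite mem_head.
by apply: IH => j jr; apply: H; rewrite in_cons jr orbT.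
Qed.

Lemma measurable_prod_in (d : measure_display) (T : measurableType d) (R : realType)
    (I : eqType) (r : seq I) (f : I -> T -> R) :
  (forall i, i \in r -> measurable_fun [set: T] (f i)) ->
  measurable_fun [set: T] (fun t => \prod_(i <- r) f i t).
Proof.
elim: r => [_|i r IH H].
  by under eq_fun do rewrite big_nil; exact: measurable_cst.
under eq_fun do rewrite big_cons.
apply: measurable_funM; first by apply: H; rewrite mem_head.
by apply: IH => j jr; apply: H; rewrite in_cons jr orbT.
Qed.

Section gaussian_family.
Context {d : measure_display} {T : measurableType d} {R : realType}.
Variables (P : probability T R) (I : finType) (W : I -> {RV P >-> R}).
Hypothesis iW : mutual_indep W.
Local Notation TJ J := (g_sigma_algebraType (rectangles W J)).
Local Notation N01 := (normal_prob (0 : R) 1).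

Lemma measurable_sub_mono (J K : pred I) (f : T -> R) : (forall i, J i -> K i) ->
  measurable_fun [set: TJ J] f -> measurable_fun [set: TJ K] f.
Proof.
move=> JK mf _ B mB; have := mf measurableT B mB; rewrite !setTI.
apply: sub_sigma_algebra2 => _ [C [mC CJ ->]].
by exists C; split=> // i iK; apply: CJ; apply: contra iK; exact: JK.
Qed.

Lemma measurable_subT (J : pred I) (f : T -> R) :
  measurable_fun [set: TJ J] f -> measurable_fun [set: T] f.
Proof.
move=> mf _ B mB; have := mf measurableT B mB; rewrite !setTI.
exact: sigma_rectangles_measurable.
Qed.

Lemma integral_prod_indep (L : eqType) (s : seq L) (J : L -> pred I) (g : L -> T -> R) :
  uniq s -> (forall k l i, J k i -> J l i -> k = l) ->
  (forall k, measurable_fun [set: TJ (J k)] (g k)) -> (forall k t, 0 <= g k t) ->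
  (\int[P]_t (\prod_(k <- s) g k t)%:E = \prod_(k <- s) \int[P]_t (g k t)%:E)%E.
Proof.
move=> + disj mg g0; elim: s => [_|k s IH /= /andP[ks us]].
  under eq_integral do rewrite big_nil.
  by rewrite big_nil integral_cst// [X in (_ * X)%E]probability_setT mule1.
pose K i := has (fun l => J l i) s.
have mprod : measurable_fun [set: TJ K] (fun t => \prod_(l <- s) g l t).
  apply: measurable_prod_in => l ls; apply: measurable_sub_mono (mg l) => i Ji.
  by apply/hasP; exists l.
have prod0 t : 0 <= \prod_(l <- s) g l t by apply: prodr_ge0 => l _.
under eq_integral do rewrite big_cons.
rewrite (@indep_fubini _ _ _ _ _ _ iW (J k) K
  (fun x => (g k x.1 * \prod_(l <- s) g l x.2)%:E)); first last.
- by move=> x; rewrite lee_fin mulr_ge0.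
- apply/measurable_EFinP/measurable_funM.
    by apply: (measurableT_comp (mg k)); exact: measurable_fst.
  by apply: (measurableT_comp mprod); exact: measurable_snd.
- move=> i ki; apply/hasPn => l ls; apply/negP => li; move: ks.
  by rewrite (disj _ _ _ ki li) ls.
rewrite big_cons -IH//.
transitivity (\int[P]_t ((g k t)%:E * \int[P]_t' (\prod_(l <- s) g l t')%:E))%E.
  apply: eq_integral => t _ /=.
  under eq_integral do rewrite EFinM.
  rewrite ge0_integralZl//.
  - by apply/measurable_EFinP; exact: measurable_subT mprod.
  - by move=> t' _; rewrite lee_fin.
  - by rewrite lee_fin.
rewrite ge0_integralZr//.
- by apply/measurable_EFinP; exact: measurable_subT (mg k).
- by move=> t _; rewrite lee_fin.
- by apply: integral_ge0 => t _; rewrite lee_fin.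
Qed.

Section std_normal.
Hypothesis lawW : forall i (B : set R), measurable B -> P (W i @^-1` B) = N01 B.

Lemma ge0_integral_std_normal (i : I) (f : R -> \bar R) :
  measurable_fun [set: R] f -> (forall x, 0 <= f x)%E ->
  (\int[P]_t f (W i t) = \int[N01]_x f x)%E.
Proof.
move=> mf f0; have mWi : measurable_fun [set: T] (W i : T -> measurableTypeR R).
  by have H := @measurable_funPT _ _ _ _ (W i); exact: H.
pose Wi : {mfun T >-> measurableTypeR R} := HB.pack (W i : T -> measurableTypeR R)
  (isMeasurableFun.Build _ _ T (measurableTypeR R) (W i : T -> measurableTypeR R) mWi).
transitivity (\int[distribution P Wi]_x f x)%E.
  by rewrite ge0_integral_distribution.
by apply: eq_measure_integral => A mA _; exact: lawW.
Qed.

(** Induction on [r]: [indep_fubini] separates the first variable, the induction hypothesis, used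
    for a translate of [h], replaces the rest by [s * z], and [integral_normal01_rotation] merges
    the two Gaussians. *)
Lemma integral_lincomb (r : seq I) (a : I -> R) (h : R -> R) : uniq r ->
  continuous h -> (forall x, 0 <= h x) ->
  (\int[P]_t (h (\sum_(i <- r) a i * W i t)%R)%:E =
   \int[N01]_z (h (Num.sqrt (\sum_(i <- r) a i ^+ 2) * z)%R)%:E)%E.
Proof.
elim: r h => [|i r IH] h /=.
  move=> _ ch h0.
  under eq_integral do rewrite big_nil.
  under [RHS]eq_integral do rewrite big_nil sqrtr0 mul0r.
  rewrite !integral_cst// [X in (_ * X)%E]probability_setT.
  by rewrite [X in _ = (_ * X)%E]probability_setT.
move=> /andP[ir ur] ch h0.
have mh : measurable_fun [set: R] h by exact: continuous_measurable_fun.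
under eq_integral do rewrite big_cons.
have msum : measurable_fun [set: TJ (mem r)] (fun t => \sum_(j <- r) a j * W j t).
  apply: measurable_sum_in => j jr; apply: measurable_funM => //.
  exact: measurable_sub_RV.
rewrite (@indep_fubini _ _ _ _ _ _ iW (pred1 i) (mem r)
  (fun x => (h (a i * W i x.1 + \sum_(j <- r) a j * W j x.2))%:E)); first last.
- by move=> x; rewrite lee_fin.
- apply/measurable_EFinP/(measurableT_comp mh)/measurable_funD.
    apply: measurable_funM => //.
    apply: (@measurableT_comp _ _ _ _ _ _ (W i : TJ (pred1 i) -> R)).
      by apply: measurable_sub_RV; rewrite /= eqxx.
    exact: measurable_fst.
  by apply: (measurableT_comp msum); exact: measurable_snd.
- by move=> j /eqP ->.
set s := Num.sqrt (\sum_(j <- r) a j ^+ 2).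
have s0 : 0 <= s by exact: sqrtr_ge0.
transitivity (\int[P]_t \int[N01]_z (h (a i * W i t + s * z))%:E)%E.
  apply: eq_integral => t _ /=.
  rewrite (IH (fun x => h (a i * W i t + x)))// => x.
  apply: continuous_comp; last exact: ch.
  by apply: cvgD; [exact: cvg_cst|exact: cvg_id].
rewrite (@ge0_integral_std_normal i
  (fun x => \int[N01]_z (h (a i * x + s * z))%:E)%E); first last.
- by move=> x; apply: integral_ge0 => z _; rewrite lee_fin.
- have mg : measurable_fun [set: R * R] (fun xz => (h (a i * xz.1 + s * xz.2))%:E).
    apply/measurable_EFinP/(measurableT_comp mh).
    by apply: measurable_funD; apply: measurable_funM.
  have g0 (xz : R * R) : (0 <= (h (a i * xz.1 + s * xz.2))%:E)%E by rewrite lee_fin.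
  have H := @measurable_fun_fubini_tonelli_F _ _ _ _ R N01 _ mg g0.
  exact: H.
rewrite integral_normal01_rotation//.
rewrite sqr_sqrtr; last by apply: sumr_ge0 => j _; rewrite sqr_ge0.
by under [RHS]eq_integral do rewrite big_cons addrC.
Qed.

Lemma integral_lincomb_expR_sqr (r : seq I) (a : I -> R) : uniq r ->
  \sum_(i <- r) a i ^+ 2 = 1 ->
  (\int[P]_t (expR ((\sum_(i <- r) a i * W i t) ^+ 2 / 4))%:E = (Num.sqrt 2)%:E)%E.
Proof.
move=> ur a1.
rewrite (@integral_lincomb r a (fun x => expR (x ^+ 2 / 4)))//.
  by rewrite a1 sqrtr1; under eq_integral do rewrite mul1r;
     exact: integral_normal01_expR_sqr.
move=> x; apply: continuous_comp; last exact: continuous_expR.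
by apply: cvgMl; exact: sqr_continuous.
Qed.

Lemma integral_lincomb_excess (r : seq I) (a : I -> R) (t : R) : uniq r -> 0 <= t ->
  \sum_(i <- r) a i ^+ 2 = 1 ->
  (\int[P]_x (Num.max (`|\sum_(i <- r) a i * W i x| - t) 0)%:E =
    (2 * (normal_pdf 0 1 t - t * (1 - Phi t)))%:E)%E.
Proof.
move=> ur t0 a1.
rewrite (@integral_lincomb r a (fun x => Num.max (`|x| - t) 0))//.
- by rewrite a1 sqrtr1; under eq_integral do rewrite mul1r;
     exact: integral_normal01_excess.
- move=> x; apply: (@continuous_max R R (fun x => `|x| - t) (fun=> 0)); last exact: cvg_cst.
  by apply: cvgB; [exact: norm_continuous|exact: cvg_cst].
- by move=> x; rewrite le_max lexx orbT.
Qed.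

End std_normal.
End gaussian_family.

(** * Contraction for exponential moments of maxima *)

Section running_max.
Context {R : realType}.

(** The maximum over the k + 1 indices 0, ..., k: never empty, so it has no default value. *)
Fixpoint maxto (B : nat -> R) (k : nat) : R :=
  if k is k'.+1 then Num.max (maxto B k') (B k) else B 0%N.

Lemma maxto_ge (B : nat -> R) (j k : nat) : (j <= k)%N -> B j <= maxto B k.
Proof.
elim: k => [|k IH] /=; first by rewrite leqn0 => /eqP ->.
by rewrite leq_eqVlt le_max => /predU1P[->|/IH ->//]; rewrite lexx orbT.
Qed.

Lemma maxto_ex (B : nat -> R) (k : nat) : exists2 j, (j <= k)%N & maxto B k = B j.
Proof.
elim: k => [|k [j jk e]] /=; first by exists 0%N.
have [_|_] := leP (maxto B k) (B k.+1); first by exists k.+1.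
by exists j => //; exact: leqW.
Qed.

Lemma maxto_le (B : nat -> R) (k : nat) (c : R) :
  (forall j, (j <= k)%N -> B j <= c) -> maxto B k <= c.
Proof. by move=> H; have [j jk ->] := maxto_ex B k; exact: H. Qed.

Lemma measurable_maxto (d : measure_display) (T : measurableType d)
    (B : T -> nat -> R) (k : nat) :
  (forall j, measurable_fun [set: T] (fun t => B t j)) ->
  measurable_fun [set: T] (fun t => maxto (B t) k).
Proof. by move=> mB; elim: k => [|k IH] /=; [exact: mB|exact: measurable_maxr]. Qed.

(** Convexity: an increment of exp is exp(start) (exp(length) - 1), which grows with the start and
    with the length. *)
Lemma expR_diff_le (x x' y y' : R) : x <= x' -> x <= y -> x' - x <= y' - y ->
  expR x' - expR x <= expR y' - expR y.
Proof.
move=> xx' xy h.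
have ex' : expR x' = expR x * expR (x' - x) by rewrite -expRD addrC subrK.
have ey' : expR y' = expR y * expR (y' - y) by rewrite -expRD addrC subrK.
have e : expR (x' - x) <= expR (y' - y) by rewrite ler_expR.
have e1 : 1 <= expR (x' - x) by rewrite -expR0 ler_expR subr_ge0.
have exy : expR x <= expR y by rewrite ler_expR.
have ex : 0 < expR x by exact: expR_gt0.
rewrite ex' ey'.
have : expR x * (expR (x' - x) - 1) <= expR y * (expR (y' - y) - 1).
  by apply: ler_pM; rewrite ?subr_ge0// ?lerD2r// expR_ge0.
by lra.
Qed.

(** p and q stand for the maximisers under the two signs. If bq <= bp, raising fp to bp gains at
    least what lowering - fq to - bq loses: the gain starts further right and bq - fq <= bp - fp. If
    bp < bq, the two points exchange roles. *)
Lemma expR_contraction2_ge0 (Ap Aq fp fq bp bq : R) : 0 <= bp -> 0 <= bq ->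
  `|fp| <= bp -> `|fq| <= bq -> `|fp - fq| <= `|bp - bq| ->
  Aq + fq <= Ap + fp -> Ap - fp <= Aq - fq ->
  expR (Ap + fp) + expR (Aq - fq) <= expR (Ap + bp) + expR (Aq - bq) \/
  expR (Ap + fp) + expR (Aq - fq) <= expR (Ap - bp) + expR (Aq + bq).
Proof.
move=> bp0 bq0; rewrite ler_norml => /andP[p1 p2].
rewrite ler_norml => /andP[q1 q2] + a1 a2.
have [bpq|bqp] := leP bq bp.
  rewrite (@ger0_norm _ (bp - bq)) ?subr_ge0// ler_norml => /andP[d1 d2]; left.
  have : expR (Aq - fq) - expR (Aq - bq) <= expR (Ap + bp) - expR (Ap + fp).
    by apply: expR_diff_le; lra.
  by lra.
rewrite (@ltr0_norm _ (bp - bq)) ?subr_lt0// ler_norml => /andP[d1 d2]; right.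
have : expR (Ap + fp) - expR (Ap - bp) <= expR (Aq + bq) - expR (Aq - fq).
  by apply: expR_diff_le; lra.
by lra.
Qed.

(* The two-point case of the Ledoux-Talagrand contraction principle for [expR]. *)
Lemma expR_contraction2 (Ap Aq fp fq bp bq : R) :
  `|fp| <= `|bp| -> `|fq| <= `|bq| -> `|fp - fq| <= `|bp - bq| ->
  Aq + fq <= Ap + fp -> Ap - fp <= Aq - fq ->
  expR (Ap + fp) + expR (Aq - fq) <= expR (Ap + bp) + expR (Aq - bq) \/
  expR (Ap + fp) + expR (Aq - fq) <= expR (Ap - bp) + expR (Aq + bq).
Proof.
have [bp0|bp0] := lerP 0 bp; have [bq0|bq0] := lerP 0 bq.
- by rewrite (ger0_norm bp0) (ger0_norm bq0); exact: expR_contraction2_ge0.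
(* When bp and bq have opposite signs, one alternative dominates term by term. *)
- rewrite (ger0_norm bp0) (ltr0_norm bq0) !ler_norml.
  move=> /andP[p1 p2] /andP[q1 q2] _ _ _; left.
  by apply: lerD; rewrite ler_expR; lra.
- rewrite (ltr0_norm bp0) (ger0_norm bq0) !ler_norml.
  move=> /andP[p1 p2] /andP[q1 q2] _ _ _; right.
  by apply: lerD; rewrite ler_expR; lra.
(* Negating both bp and bq reduces to the nonnegative case and swaps the alternatives. *)
- rewrite (ltr0_norm bp0) (ltr0_norm bq0) => p q pq a1 a2.
  have := @expR_contraction2_ge0 Ap Aq fp fq (- bp) (- bq).
  have -> : - bp - - bq = - (bp - bq) by ring.
  rewrite !opprK normrN !oppr_ge0 => H; apply/or_comm; apply: H => //; exact: ltW.
Qed.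

(** Indices p and q attain the two maxima on the left; in either alternative of [expR_contraction2]
    the bound consists of one value below each maximum on the right. This is contraction for a
    single random sign. *)
Lemma maxto_contraction (phi : R -> R) (A b : nat -> R) (th : R) (k : nat) :
  phi 0 = 0 -> (forall x y, `|phi x - phi y| <= `|x - y|) -> 0 <= th ->
  expR (maxto (fun j => A j + th * phi (b j)) k) +
  expR (maxto (fun j => A j - th * phi (b j)) k) <=
  expR (maxto (fun j => A j + th * b j) k) + expR (maxto (fun j => A j - th * b j) k).
Proof.
move=> phi0 Lphi th0.
have Lt x y : `|th * phi x - th * phi y| <= `|th * x - th * y|.
  by rewrite -!mulrBr !normrM ler_wpM2l.
have Lt0 x : `|th * phi x| <= `|th * x|.
  by have := Lt x 0; rewrite phi0 !mulr0 !subr0.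
set f1 := fun j => A j + th * phi (b j); set f2 := fun j => A j - th * phi (b j).
have [p pk ep] := maxto_ex f1 k; have [q qk eq] := maxto_ex f2 k.
have h1 : A q + th * phi (b q) <= A p + th * phi (b p).
  by rewrite -[leRHS]/(f1 p) -ep; exact: (@maxto_ge f1).
have h2 : A p - th * phi (b p) <= A q - th * phi (b q).
  by rewrite -[leRHS]/(f2 q) -eq; exact: (@maxto_ge f2).
rewrite ep eq /f1 /f2.
have gp j : (j <= k)%N -> expR (A j + th * b j) <= expR (maxto (fun j => A j + th * b j) k).
  by move=> jk; rewrite ler_expR; exact: (@maxto_ge (fun j => A j + th * b j)).
have gm j : (j <= k)%N -> expR (A j - th * b j) <= expR (maxto (fun j => A j - th * b j) k).
  by move=> jk; rewrite ler_expR; exact: (@maxto_ge (fun j => A j - th * b j)).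
have [|] := expR_contraction2 (Lt0 (b p)) (Lt0 (b q)) (Lt (b p) (b q)) h1 h2.
  by move=> /le_trans; apply; apply: lerD; [exact: gp|exact: gm].
by move=> /le_trans; apply; rewrite addrC; apply: lerD; [exact: gp|exact: gm].
Qed.

Lemma expR_mid_le (x y : R) : expR ((x + y) / 2) <= (expR x + expR y) / 2.
Proof.
have -> : expR x = expR (x / 2) ^+ 2 by rewrite -expRM_natr mulr_natr; congr expR; lra.
have -> : expR y = expR (y / 2) ^+ 2 by rewrite -expRM_natr mulr_natr; congr expR; lra.
have -> : (x + y) / 2 = x / 2 + y / 2 by lra.
by rewrite expRD; have := sqr_ge0 (expR (x / 2) - expR (y / 2)); nra.
Qed.

End running_max.

(** * The clipped absolute value and contraction for one row *)

Section clip.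
Context {R : realType}.

(** Equal to min(|x|, 2t - |x|); written through the excess of |x| over t so that its mean follows
    from [integral_normal01_excess]. *)
Definition clip (t x : R) : R := `|x| - 2 * Num.max (`|x| - t) 0.

Lemma clip0 (t : R) : 0 <= t -> clip t 0 = 0.
Proof. by move=> t0; rewrite /clip normr0 max_r ?mulr0 ?subr0//; lra. Qed.

Lemma clip_lipschitz (t x y : R) : `|clip t x - clip t y| <= `|x - y|.
Proof.
apply: (@le_trans _ _ (`| `|x| - `|y| |)); last exact: ler_dist_dist.
suff H (a b : R) :
    `|a - 2 * Num.max (a - t) 0 - (b - 2 * Num.max (b - t) 0)| <= `|a - b|.
  exact: H.
have [h|h] := lerP 0 (a - b); [rewrite (ger0_norm h)|rewrite (ltr0_norm h)];
  by case: (lerP (a - t) 0) => ha; case: (lerP (b - t) 0) => hb;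
  rewrite ler_norml; apply/andP; split; lra.
Qed.

Lemma clip_le_norm (t x : R) : clip t x <= `|x|.
Proof. by rewrite /clip; case: (lerP (`|x| - t) 0) => h; lra. Qed.

Lemma clip_le_compl (t x : R) : clip t x <= 2 * t - `|x|.
Proof. by rewrite /clip; case: (lerP (`|x| - t) 0) => h; lra. Qed.

Lemma measurable_clip (t : R) : measurable_fun [set: R] (clip t).
Proof.
apply: measurable_funB; first exact: normr_measurable.
apply: measurable_funM => //; apply: measurable_maxr => //.
by apply: measurable_funB => //; exact: normr_measurable.
Qed.

Section jensen.
Context {d : measure_display} {T : measurableType d}.
Variable P : probability T R.

(** Jensen through the tangent of exp at th c, where c = [e0 - 2 * et] is the mean of the clipped
    variable. *)
Lemma jensen_clip (t th e0 et : R) (X : T -> R) : measurable_fun [set: T] X -> 0 <= th ->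
  0 <= e0 - 2 * et ->
  (\int[P]_x `|X x|%:E = e0%:E)%E ->
  (\int[P]_x (Num.max (`|X x| - t) 0)%:E = et%:E)%E ->
  ((expR (th * (e0 - 2 * et)))%:E <= \int[P]_x (expR (th * clip t (X x)))%:E)%E.
Proof.
move=> mX th0 c0 h0 ht; set c := e0 - 2 * et.
have mabs : measurable_fun [set: T] (fun x => `|X x|%:E).
  by apply/measurable_EFinP; exact: measurableT_comp.
have mexc : measurable_fun [set: T] (fun x => (Num.max (`|X x| - t) 0)%:E).
  apply/measurable_EFinP/measurable_maxr => //.
  by apply: measurable_funB => //; exact: measurableT_comp.
have mexp : measurable_fun [set: T] (fun x => (expR (th * clip t (X x)))%:E).
  apply/measurable_EFinP; apply: measurableT_comp => //; apply: measurable_funM => //.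
  by apply: (measurableT_comp (measurable_clip t)).
have E0 : 0 <= expR (th * c) by exact: expR_ge0.
have exc0 x : 0 <= Num.max (`|X x| - t) 0 by rewrite le_max lexx orbT.
have Ic (r : R) : (\int[P]_(x in [set: T]) r%:E = r%:E)%E.
  by rewrite integral_cst// [X in (_ * X)%E]probability_setT mule1.
pose a := expR (th * c); pose b := expR (th * c) * th.
have b0 : 0 <= b by rewrite mulr_ge0.
(* The tangent inequality a + b (clip - c) <= exp(th clip), with its negative terms moved across so
   that both sides are integrals of nonnegative functions. *)
have : (\int[P]_x (a%:E + b%:E * `|X x|%:E) <=
    \int[P]_x ((expR (th * clip t (X x)))%:E +
      ((2 * b)%:E * (Num.max (`|X x| - t) 0)%:E + (b * c)%:E)))%E.
  apply: ge0_le_integral => //.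
  - by move=> x _; rewrite -EFinM -EFinD lee_fin addr_ge0// mulr_ge0.
  - by apply: emeasurable_funD => //; exact: emeasurable_funM.
  - apply: emeasurable_funD => //; apply: emeasurable_funD => //.
    exact: emeasurable_funM.
  - move=> x _; rewrite -!EFinM -!EFinD lee_fin.
    have := expR_ge1Dx (th * (clip t (X x) - c)).
    rewrite mulrBr expRB ler_pdivlMr ?expR_gt0// -/a => H.
    rewrite -subr_ge0; move: H; rewrite -subr_ge0.
    suff -> : forall e : R, e + (2 * b * Num.max (`|X x| - t) 0 + b * c) - (a + b * `|X x|) =
        e - (1 + (th * clip t (X x) - th * c)) * a by [].
    by move=> e; rewrite /b /clip -/a; ring.
rewrite ge0_integralD//; last 2 first.
- by move=> x _; rewrite -EFinM lee_fin mulr_ge0.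
- exact: emeasurable_funM.
have exc0' x : setT x -> (0 <= (Num.max (`|X x| - t) 0)%:E)%E by rewrite lee_fin.
have b20 : (0 <= (2 * b)%:E)%E by rewrite lee_fin mulr_ge0.
rewrite [X in (_ <= X)%E]ge0_integralD; last first.
- by apply: emeasurable_funD => //; exact: emeasurable_funM.
- by move=> x _; rewrite -EFinM -EFinD lee_fin addr_ge0// mulr_ge0// mulr_ge0.
- exact: mexp.
- by move=> x _; rewrite lee_fin expR_ge0.
- exact: measurableT.
rewrite [X in (_ <= _ + X)%E]ge0_integralD; last first.
- exact: measurable_cst.
- by move=> x _; rewrite lee_fin mulr_ge0.
- exact: emeasurable_funM.
- by move=> x _; rewrite -EFinM lee_fin mulr_ge0// mulr_ge0.
- exact: measurableT.
rewrite !ge0_integralZl//.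
rewrite !Ic h0 ht -!EFinM -!EFinD.
have -> : 2 * b * et + b * c = b * e0 by rewrite /c; ring.
by rewrite EFinD leeD2rE.
Qed.

(* One row of symmetrization and contraction: no ghost sample is needed because
   the mean [c] of [clip t (b j)] does not depend on [j]. *)
Lemma row_contraction (t lam e0 et : R) (A : nat -> R) (b : nat -> T -> R) (k : nat) :
  0 <= t -> 0 <= lam -> 0 <= e0 - 2 * et ->
  (forall j, measurable_fun [set: T] (b j)) ->
  (forall j, (\int[P]_x `|b j x|%:E = e0%:E)%E) ->
  (forall j, (\int[P]_x (Num.max (`|b j x| - t) 0)%:E = et%:E)%E) ->
  (\int[P]_x (expR (maxto (fun j => A j + lam * ((e0 - 2 * et) - clip t (b j x))) k))%:E <=
   2^-1%:E * (\int[P]_x (expR (maxto (fun j => A j + 2 * lam * b j x) k))%:E +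
              \int[P]_x (expR (maxto (fun j => A j - 2 * lam * b j x) k))%:E))%E.
Proof.
move=> t0 lam0 c0 mb h0 ht; set c := e0 - 2 * et.
have mclip j : measurable_fun [set: T] (fun x => clip t (b j x)).
  by apply: (measurableT_comp (measurable_clip t)).
have mlin (s : R) : measurable_fun [set: T]
    (fun x => (expR (maxto (fun j => A j + s * b j x) k))%:E).
  apply/measurable_EFinP; apply: measurableT_comp => //.
  by apply: measurable_maxto => j; apply: measurable_funD => //; exact: measurable_funM.
have mclp (s : R) : measurable_fun [set: T]
    (fun x => (expR (maxto (fun j => A j + s * clip t (b j x)) k))%:E).
  apply/measurable_EFinP; apply: measurableT_comp => //.
  by apply: measurable_maxto => j; apply: measurable_funD => //; exact: measurable_funM.
have mL : measurable_fun [set: T]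
    (fun x => (expR (maxto (fun j => A j + lam * (c - clip t (b j x))) k))%:E).
  apply/measurable_EFinP; apply: measurableT_comp => //.
  apply: measurable_maxto => j; apply: measurable_funD => //; apply: measurable_funM => //.
  exact: measurable_funB.
have e0' (f : T -> R) x : setT x -> (0 <= (expR (f x))%:E)%E.
  by move=> _; rewrite lee_fin expR_ge0.
have i2 : (0 <= (2^-1 : R)%:E)%E by rewrite lee_fin.
(* Each exponent is the midpoint of [A j + 2 * lam * c] and [A j - 2 * lam * clip t (b j x)];
   convexity of exp separates the mean from the sample. *)
apply: (@le_trans _ _ (\int[P]_x (2^-1%:E * ((expR (maxto A k + 2 * lam * c))%:E +
    (expR (maxto (fun j => A j + (- (2 * lam)) * clip t (b j x)) k))%:E)))%E).
  apply: ge0_le_integral => //.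
  - by apply: emeasurable_funM => //; apply: emeasurable_funD.
  - move=> x _; rewrite -EFinD -EFinM lee_fin mulrC.
    apply: le_trans (expR_mid_le _ _); rewrite ler_expR; apply: maxto_le => j jk.
    have := maxto_ge A jk.
    have := maxto_ge (fun j => A j + (- (2 * lam)) * clip t (b j x)) jk.
    by lra.
rewrite ge0_integralZl//; last 2 first.
- by apply: emeasurable_funD.
- by move=> x _; rewrite -EFinD lee_fin addr_ge0// expR_ge0.
apply: lee_wpmul2l => //.
rewrite ge0_integralD//.
rewrite integral_cst// [X in (_ * X)%E]probability_setT mule1.
(* At an index p maximising [A], [jensen_clip] replaces the mean c by the clipped variable itself.
   The two signs are then in place for [maxto_contraction]. *)
apply: (@le_trans _ _ (\int[P]_x (expR (maxto (fun j => A j + 2 * lam * clip t (b j x)) k))%:E +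
   \int[P]_x (expR (maxto (fun j => A j + (- (2 * lam)) * clip t (b j x)) k))%:E)%E).
  apply: leeD => //; have [p pk ->] := maxto_ex A k.
  rewrite expRD EFinM.
  apply: (@le_trans _ _ ((expR (A p))%:E *
      \int[P]_x (expR (2 * lam * clip t (b p x)))%:E)%E).
    apply: lee_wpmul2l; first by rewrite lee_fin expR_ge0.
    by apply: jensen_clip => //; rewrite mulr_ge0.
  rewrite -ge0_integralZl; last first.
  - by rewrite lee_fin expR_ge0.
  - exact: e0'.
  - by apply/measurable_EFinP; apply: measurableT_comp => //; exact: measurable_funM.
  - exact: measurableT.
  apply: ge0_le_integral.
  - exact: measurableT.
  - by move=> x _; rewrite -EFinM lee_fin mulr_ge0// expR_ge0.
  - apply: emeasurable_funM => //.
    by apply/measurable_EFinP; apply: measurableT_comp => //; exact: measurable_funM.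
  - exact: mclp.
  - move=> x _; rewrite -EFinM -expRD lee_fin ler_expR.
    exact: (@maxto_ge _ (fun j => A j + 2 * lam * clip t (b j x))).
have mlinN : measurable_fun [set: T]
    (fun x => (expR (maxto (fun j => A j - 2 * lam * b j x) k))%:E).
  by under eq_fun do under eq_fun do rewrite -mulNr; exact: mlin.
rewrite -!ge0_integralD//.
apply: ge0_le_integral.
- exact: measurableT.
- by move=> x _; rewrite -EFinD lee_fin addr_ge0// expR_ge0.
- exact: emeasurable_funD.
- by apply: emeasurable_funD => //; exact: mlinN.
- move=> x _; rewrite -!EFinD lee_fin.
  have -> : (fun j => A j + - (2 * lam) * clip t (b j x)) =
      (fun j => A j - 2 * lam * clip t (b j x)).
    by apply/funext => j; rewrite mulNr.
  apply: maxto_contraction; [exact: clip0|exact: clip_lipschitz|exact: mulr_ge0].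
Qed.

End jensen.
End clip.

(** * Exponential moments for a Gaussian matrix *)

Lemma measurable_expR_maxto (d1 d2 : measure_display) (T1 : measurableType d1)
    (T2 : measurableType d2) (R : realType) (A : nat -> T1 -> R) (g : nat -> T2 -> R)
    (k : nat) :
  (forall j, measurable_fun [set: T1] (A j)) ->
  (forall j, measurable_fun [set: T2] (g j)) ->
  measurable_fun [set: T1 * T2]
    (fun x => (expR (maxto (fun j => A j x.1 + g j x.2) k))%:E).
Proof.
move=> mA mg; apply/measurable_EFinP; apply: measurableT_comp => //.
apply: measurable_maxto => j; apply: measurable_funD.
  by apply: (measurableT_comp (mA j)); exact: measurable_fst.
by apply: (measurableT_comp (mg j)); exact: measurable_snd.
Qed.

Section chernoff.
Context {d : measure_display} {T : measurableType d} {R : realType}.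
Variables (P : probability T R).

Lemma chernoff_bound (Y : T -> R) (a : R) : measurable_fun [set: T] Y ->
  (P [set w : T | (a < Y w)%R] * (expR a)%:E <= \int[P]_w (expR (Y w))%:E)%E.
Proof.
move=> mY.
have mE : measurable [set w : T | (a < Y w)%R].
  have := mY measurableT _ (measurable_itv `]a, +oo[).
  rewrite setTI; congr measurable.
  by apply/seteqP; split => w /=; rewrite in_itv/= andbT.
apply: (@le_trans _ _ (\int[P]_(w in [set w : T | (a < Y w)%R]) (expR a)%:E)%E).
  by rewrite integral_cst// muleC.
apply: (@le_trans _ _ (\int[P]_(w in [set w : T | (a < Y w)%R]) (expR (Y w))%:E)%E).
  apply: ge0_le_integral.
  - exact: mE.
  - by move=> w _; rewrite lee_fin expR_ge0.
  - exact: measurable_cst.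
  - by apply/measurable_EFinP/measurable_funTS; exact: measurableT_comp.
  - by move=> w /= aY; rewrite lee_fin ler_expR ltW.
apply: ge0_subset_integral.
- exact: mE.
- exact: measurableT.
- by apply/measurable_EFinP; exact: measurableT_comp.
- by move=> w _; rewrite lee_fin expR_ge0.
- by [].
Qed.

End chernoff.

Section row_step.
Context {d : measure_display} {T : measurableType d} {R : realType}.
Variables (P : probability T R) (I : finType) (W : I -> {RV P >-> R}).
Hypothesis iW : mutual_indep W.
Local Notation TJ J := (g_sigma_algebraType (rectangles W J)).

(** [indep_fubini] freezes the variables in [J], so that each [A j] becomes a constant and
    [row_contraction] applies pointwise. *)
Lemma indep_row_contraction (J K : pred I) (t lam e0 et : R) (A b : nat -> T -> R) (k : nat) :
  (forall i, J i -> ~~ K i) ->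
  0 <= t -> 0 <= lam -> 0 <= e0 - 2 * et ->
  (forall j, measurable_fun [set: TJ J] (A j)) ->
  (forall j, measurable_fun [set: TJ K] (b j)) ->
  (forall j, (\int[P]_x `|b j x|%:E = e0%:E)%E) ->
  (forall j, (\int[P]_x (Num.max (`|b j x| - t) 0)%:E = et%:E)%E) ->
  (\int[P]_x (expR (maxto (fun j => A j x + lam * ((e0 - 2 * et) - clip t (b j x))) k))%:E <=
   2^-1%:E * (\int[P]_x (expR (maxto (fun j => A j x + 2 * lam * b j x) k))%:E +
              \int[P]_x (expR (maxto (fun j => A j x - 2 * lam * b j x) k))%:E))%E.
Proof.
move=> JK t0 lam0 c0 mA mb h0 ht.
pose I2 (g : nat -> T -> R) x := (\int[P]_x' (expR (maxto (fun j => A j x + g j x')%R k))%:E)%E.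
have fub (g : nat -> T -> R) : (forall j, measurable_fun [set: TJ K] (g j)) ->
    (\int[P]_x (expR (maxto (fun j => A j x + g j x)%R k))%:E = \int[P]_x I2 g x)%E.
  move=> mg.
  rewrite (@indep_fubini _ _ _ _ _ _ iW J K
    (fun x => (expR (maxto (fun j => A j x.1 + g j x.2) k))%:E))//.
  exact: measurable_expR_maxto.
have mI (g : nat -> T -> R) : (forall j, measurable_fun [set: TJ K] (g j)) ->
    measurable_fun [set: T] (I2 g).
  move=> mg.
  have mF : measurable_fun [set: T * T]
      (fun x => (expR (maxto (fun j => A j x.1 + g j x.2) k))%:E).
    by apply: measurable_expR_maxto => j; apply: measurable_subT; [exact: mA|exact: mg].
  have F0 (x : T * T) : (0 <= (expR (maxto (fun j => A j x.1 + g j x.2)%R k))%:E)%E.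
    by rewrite lee_fin expR_ge0.
  exact: (@measurable_fun_fubini_tonelli_F _ _ _ _ R P _ mF F0).
have I0 g x : (0 <= I2 g x)%E.
  by apply: integral_ge0 => x' _; rewrite lee_fin expR_ge0.
pose g1 j x := lam * ((e0 - 2 * et) - clip t (b j x)).
pose g2 j x := 2 * lam * b j x.
pose g3 j x := - (2 * lam * b j x).
have mg1 j : measurable_fun [set: TJ K] (g1 j).
  apply: measurable_funM => //; apply: measurable_funB => //.
  exact: (measurableT_comp (measurable_clip t)).
have mg2 j : measurable_fun [set: TJ K] (g2 j) by exact: measurable_funM.
have mg3 j : measurable_fun [set: TJ K] (g3 j).
  by apply: measurableT_comp => //; exact: mg2.
rewrite (fub g1 mg1) (fub g2 mg2) (fub g3 mg3).
rewrite -ge0_integralD; last first.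
- exact: mI.
- by move=> x _; exact: I0.
- exact: mI.
- by move=> x _; exact: I0.
- exact: measurableT.
rewrite -ge0_integralZl; last first.
- by rewrite lee_fin.
- by move=> x _; rewrite adde_ge0.
- by apply: emeasurable_funD; exact: mI.
- exact: measurableT.
apply: ge0_le_integral.
- exact: measurableT.
- by move=> x _; exact: I0.
- exact: mI.
- by apply: emeasurable_funM => //; apply: emeasurable_funD; exact: mI.
- move=> x _; apply: row_contraction => // j.
  exact: measurable_subT (mb j).
Qed.

End row_step.

Section gaussian_matrix.
Context {d : measure_display} {T : measurableType d} {R : realType} {m n : nat}.
Variables (P : probability T R) (W : 'I_m * 'I_n -> {RV P >-> R}).
Hypothesis iW : mutual_indep W.
Hypothesis lawW : forall p (B : set R), measurable B ->
  P (W p @^-1` B) = normal_prob (0 : R) 1 B.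
Local Notation TJ J := (g_sigma_algebraType (rectangles W J)).
Variable u : nat -> 'I_n -> R.
Hypothesis u1 : forall k, \sum_j u k j ^+ 2 = 1.

Definition row_dot (i : 'I_m) (k : nat) (w : T) : R := \sum_j u k j * W (i, j) w.

Lemma measurable_row_dot (J : pred ('I_m * 'I_n)) i k : (forall j, J (i, j)) ->
  measurable_fun [set: TJ J] (row_dot i k).
Proof.
move=> Ji; apply: measurable_sum_in => j _; apply: measurable_funM => //.
exact: measurable_sub_RV.
Qed.

Lemma row_dot_excess (t : R) i k : 0 <= t ->
  (\int[P]_w (Num.max (`|row_dot i k w| - t) 0)%:E =
    (2 * (normal_pdf 0 1 t - t * (1 - Phi t)))%:E)%E.
Proof.
move=> t0; pose r := [seq (i, j) | j <- enum 'I_n].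
have sumr (F : 'I_m * 'I_n -> R) : \sum_(p <- r) F p = \sum_j F (i, j).
  by rewrite big_map big_enum.
rewrite -(@integral_lincomb_excess _ _ _ _ _ W iW lawW r (fun p => u k p.2) t)//.
- by apply: eq_integral => w _; rewrite sumr.
- by rewrite map_inj_uniq ?enum_uniq// => j j' [].
- by rewrite sumr.
Qed.

Lemma row_dot_abs i k : (\int[P]_w `|row_dot i k w|%:E = (2 * normal_pdf 0 1 0)%:E)%E.
Proof.
have := row_dot_excess i k (lexx 0); rewrite mul0r subr0 => <-.
by apply: eq_integral => w _; rewrite subr0 max_l.
Qed.

(** A coordinate of the signed sum of rows, scaled by the square root of m to be N(0,1); the boolean
    [s i] encodes the sign of row i. *)
Definition col_sum (s : 'I_m -> bool) (j : 'I_n) (w : T) : R :=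
  \sum_i (-1) ^+ s i / Num.sqrt m%:R * W (i, j) w.

Lemma col_sum_expR_sqr s j : (0 < m)%N ->
  (\int[P]_w (expR (col_sum s j w ^+ 2 / 4))%:E = (Num.sqrt 2)%:E)%E.
Proof.
move=> m0; pose r := [seq (i, j) | i <- enum 'I_m].
have sumr (F : 'I_m * 'I_n -> R) : \sum_(p <- r) F p = \sum_i F (i, j).
  by rewrite big_map big_enum.
rewrite -(@integral_lincomb_expR_sqr _ _ _ _ _ W iW lawW r
  (fun p => (-1) ^+ s p.1 / Num.sqrt m%:R))//.
- by apply: eq_integral => w _; rewrite sumr.
- by rewrite map_inj_uniq ?enum_uniq// => i i' [].
- rewrite sumr; under eq_bigr do rewrite expr_div_n sqrr_sign sqr_sqrtr// div1r.
  by rewrite sumr_const card_ord -[LHS]mulr_natr mulVf// pnatr_eq0 -lt0n.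
Qed.

(** Completing the square bounds every direction at once by a quantity free of [u], hence the
    independence of [k]. That quantity is a product over the columns, which are independent, and
    each column contributes sqrt 2. *)
Lemma signed_mgf_bound (lam : R) (s : 'I_m -> bool) (k : nat) : (0 < m)%N ->
  (\int[P]_w (expR (maxto (fun l => \sum_i 2 * lam * ((-1) ^+ s i * row_dot i l w)) k))%:E
    <= (expR (4 * lam ^+ 2 * m%:R) * Num.sqrt 2 ^+ n)%:E)%E.
Proof.
move=> m0.
have sm0 : 0 < Num.sqrt (m%:R : R) by rewrite sqrtr_gt0 ltr0n.
have sm2 : Num.sqrt (m%:R : R) ^+ 2 = m%:R by rewrite sqr_sqrtr.
pose g j w := expR (col_sum s j w ^+ 2 / 4).
have mcol (J : pred ('I_m * 'I_n)) j : (forall i, J (i, j)) ->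
    measurable_fun [set: TJ J] (g j).
  move=> Jj; apply: measurableT_comp => //; apply: measurable_funM => //.
  apply: measurable_funX; apply: measurable_sum_in => i _; apply: measurable_funM => //.
  exact: measurable_sub_RV.
have mg j : measurable_fun [set: T] (g j) by apply: (measurable_subT (mcol xpredT j _)).
apply: (@le_trans _ _ (\int[P]_w ((expR (4 * lam ^+ 2 * m%:R))%:E *
    (\prod_(j <- enum 'I_n) g j w)%:E))%E).
  apply: ge0_le_integral.
  - exact: measurableT.
  - by move=> w _; rewrite lee_fin expR_ge0.
  - apply/measurable_EFinP; apply: measurableT_comp => //; apply: measurable_maxto => l.
    apply: measurable_sum_in => i _; apply: measurable_funM => //; apply: measurable_funM => //.
    exact: (measurable_subT (measurable_row_dot (J := xpredT) _ _)).
  - apply: emeasurable_funM => //; apply/measurable_EFinP.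
    by apply: measurable_prod_in => j _; exact: mg.
  - move=> w _; rewrite -EFinM lee_fin big_enum/= -expR_sum -expRD ler_expR.
    apply: maxto_le => l _.
    (* The constant is spread over the coordinates with weights [u l j ^+ 2] of sum 1, so that the
       inequality holds coordinate by coordinate. *)
    have -> : 4 * lam ^+ 2 * m%:R = \sum_j 4 * lam ^+ 2 * m%:R * u l j ^+ 2.
      by rewrite -mulr_sumr u1 mulr1.
    rewrite -big_split/=.
    have -> : \sum_i 2 * lam * ((-1) ^+ s i * row_dot i l w) =
        \sum_j 2 * lam * Num.sqrt m%:R * u l j * col_sum s j w.
      under eq_bigr do rewrite /row_dot !mulr_sumr.
      rewrite exchange_big/=; apply: eq_bigr => j _.
      rewrite /col_sum mulr_sumr; apply: eq_bigr => i _.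
      by field; rewrite gt_eqF.
    apply: ler_sum => j _.
    move: sm2; set r := Num.sqrt _ => <-; rewrite -subr_ge0.
    rewrite [leRHS](_ : _ = (2 * lam * r * u l j - col_sum s j w / 2) ^+ 2) ?sqr_ge0//.
    by field.
rewrite ge0_integralZl; last first.
- by rewrite lee_fin expR_ge0.
- by move=> w _; rewrite lee_fin prodr_ge0// => j _; exact: expR_ge0.
- by apply/measurable_EFinP; apply: measurable_prod_in => j _; exact: mg.
- exact: measurableT.
rewrite (@integral_prod_indep _ _ _ _ _ W iW _ _ (fun j p => p.2 == j)); last first.
- by move=> j w; exact: expR_ge0.
- by move=> j; apply: mcol => i /=.
- by move=> j l p /eqP <- /eqP.
- exact: enum_uniq.
rewrite EFinM lee_wpmul2l ?lee_fin ?expR_ge0//.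
under eq_bigr do rewrite col_sum_expR_sqr//.
by rewrite big_enum/= prodEFin prodr_const card_ord.
Qed.

(** Hybrid argument: rows below p carry the clipped term, the others a signed linear term. Passing
    from p to p + 1 bounds the new moment by the average of two hybrids that differ in the sign of
    row p, so the induction quantifies over all signs. *)
Lemma clip_mgf_bound (t lam : R) (k : nat)
    (c := 2 * normal_pdf 0 1 0 - 2 * (2 * (normal_pdf 0 1 t - t * (1 - Phi t)))) :
  (0 < m)%N -> 0 <= t -> 0 <= lam -> 0 <= c ->
  (\int[P]_w (expR (maxto (fun l => \sum_i lam * (c - clip t (row_dot i l w))) k))%:E
    <= (expR (4 * lam ^+ 2 * m%:R) * Num.sqrt 2 ^+ n)%:E)%E.
Proof.
move=> m0 t0 lam0 c0; set B := (expR _ * _)%:E.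
pose term p (s : 'I_m -> bool) (i : 'I_m) l w :=
  if (i < p)%N then lam * (c - clip t (row_dot i l w))
  else 2 * lam * ((-1) ^+ s i * row_dot i l w).
suff H p : (p <= m)%N -> forall s,
    (\int[P]_w (expR (maxto (fun l => \sum_i term p s i l w) k))%:E <= B)%E.
  have := H m (leqnn m) (fun=> false).
  by under eq_integral => w _ do under eq_fun => l do
    under eq_bigr => i _ do rewrite /term ltn_ord.
elim: p => [_ s|p IH pm s].
  under eq_integral => w _ do under eq_fun => l do
    under eq_bigr => i _ do rewrite /term ltn0.
  exact: signed_mgf_bound.
pose i0 := Ordinal pm.
pose J (q : 'I_m * 'I_n) := q.1 != i0.
pose K (q : 'I_m * 'I_n) := q.1 == i0.
pose A l w := \sum_(i | i != i0) term p s i l w.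
have mA l : measurable_fun [set: TJ J] (A l).
  have -> : A l = fun w => \sum_i (if i != i0 then term p s i l w else 0).
    by apply/funext => w; rewrite /A big_mkcond.
  apply: measurable_sum_in => i _; case: (boolP (i != i0)) => //= ii0.
  have mr : measurable_fun [set: TJ J] (row_dot i l) by apply: measurable_row_dot.
  rewrite /term; case: (i < p)%N; apply: measurable_funM => //.
    by apply: measurable_funB => //; exact: (measurableT_comp (measurable_clip t)).
  exact: measurable_funM.
have mb l : measurable_fun [set: TJ K] (row_dot i0 l).
  by apply: measurable_row_dot => j; rewrite /K/=.
have JK q : J q -> ~~ K q by [].
have := @indep_row_contraction _ _ _ _ _ W iW J K t lam _ _ A (row_dot i0) k JK
  t0 lam0 c0 mA mb (row_dot_abs i0) (fun l => row_dot_excess i0 l t0).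
rewrite -/c => le_step.
have eqA l w : \sum_i term p.+1 s i l w = A l w + lam * (c - clip t (row_dot i0 l w)).
  rewrite (bigD1 i0)//= addrC; congr (_ + _); last by rewrite /term /= ltnSn.
  apply: eq_bigr => i ii0; rewrite /term ltnS leq_eqVlt.
  by have /negbTE -> : (i : nat) != p by apply: contra ii0 => /eqP ip; exact/eqP/val_inj.
pose s' (e : bool) i := if i == i0 then e else s i.
have eqs e l w : \sum_i term p (s' e) i l w = A l w + 2 * lam * ((-1) ^+ e * row_dot i0 l w).
  rewrite (bigD1 i0)//= addrC; congr (_ + _).
    by apply: eq_bigr => i ii0; rewrite /term /s' (negbTE ii0).
  by rewrite /term /s' /= ltnn eqxx.
under eq_integral => w _ do under eq_fun => l do rewrite eqA.
apply: (le_trans le_step).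
have pm' : (p <= m)%N by exact: ltnW.
have := IH pm' (s' false).
under eq_integral => w _ do under eq_fun => l do rewrite eqs expr0 mul1r.
move=> hp; have := IH pm' (s' true).
under eq_integral => w _ do under eq_fun => l do rewrite eqs expr1 mulN1r mulrN.
move=> hm.
apply: (@le_trans _ _ (2^-1%:E * (B + B))%E).
  by apply: lee_wpmul2l; [rewrite lee_fin|exact: leeD].
by rewrite /B -EFinD -EFinM lee_fin; lra.
Qed.

End gaussian_matrix.

(** * Deterministic part *)

Section deterministic.
Context {R : realType}.

(** A triangle inequality with the error measured in l1. After squaring, it reduces to |v_j| <= V
    and |h_j - v_j| <= D. *)
Lemma sqrt_sum_sqr_le (n : nat) (h v : 'I_n -> R) :
  Num.sqrt (\sum_j h j ^+ 2) <= Num.sqrt (\sum_j v j ^+ 2) + \sum_j `|h j - v j|.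
Proof.
set V := Num.sqrt (\sum_j v j ^+ 2); set D := \sum_j `|h j - v j|.
have V0 : 0 <= V by exact: sqrtr_ge0.
have D0 : 0 <= D by apply: sumr_ge0.
have sv : 0 <= \sum_j v j ^+ 2 by apply: sumr_ge0 => j _; exact: sqr_ge0.
have vV j : `|v j| <= V.
  rewrite -sqrtr_sqr ler_wsqrtr// (bigD1 j)//= lerDl.
  by apply: sumr_ge0 => l _; exact: sqr_ge0.
have hD j : `|h j - v j| <= D.
  by rewrite /D (bigD1 j)//= lerDl; apply: sumr_ge0.
rewrite -[leRHS]ger0_norm ?addr_ge0// -sqrtr_sqr ler_wsqrtr//.
have -> : (V + D) ^+ 2 = \sum_j v j ^+ 2 + (2 * V * D + D * D).
  by rewrite -[\sum_j _ ^+ 2]sqr_sqrtr// -/V; ring.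
have -> : 2 * V * D + D * D = \sum_j (2 * V * `|h j - v j| + D * `|h j - v j|).
  by rewrite big_split/= -!mulr_sumr.
rewrite -big_split/=; apply: ler_sum => j _.
have vj := vV j; have := hD j; set y := h j - v j => hy.
have -> : h j = v j + y by rewrite addrC subrK.
have hvy : v j * y <= V * `|y|.
  by rewrite (le_trans (ler_norm _))// normrM ler_wpM2r.
have hyy : y ^+ 2 <= D * `|y|.
  by rewrite -real_normK ?num_real// expr2 ler_wpM2r.
by rewrite sqrrD mulr2n; lra.
Qed.

Lemma rat_dense_vec (n : nat) (h : 'I_n -> R) (e : R) : 0 < e ->
  exists v : {ffun 'I_n -> rat}, forall j, `|h j - ratr (v j)| <= e.
Proof.
move=> e0.
have /fin_all_exists[v hv] : forall j, exists q : rat, `|h j - ratr q| <= e.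
  move=> j; have : h j - e < h j + e by lra.
  move=> /rat_in_itvoo[q]; rewrite in_itv/= => /andP[q1 q2].
  by exists q; rewrite ler_norml; apply/andP; split; lra.
by exists (finfun v) => j; rewrite ffunE.
Qed.

(** Both sides are Lipschitz in the vector, so the bound passes from rational to real vectors. *)
Lemma signed_l1_rat_real (m n : nat) (A : 'M[R]_(m, n)) (s : 'I_m -> R) (kap : R) :
  0 <= kap -> (forall i, `|s i| <= 1) ->
  (forall v : {ffun 'I_n -> rat}, kap * Num.sqrt (\sum_j (ratr (v j) : R) ^+ 2) <=
     \sum_i s i * `|\sum_j A i j * ratr (v j)|) ->
  forall h : 'I_n -> R, kap * Num.sqrt (\sum_j h j ^+ 2) <=
     \sum_i s i * `|\sum_j A i j * h j|.
Proof.
move=> kap0 s1 H h; apply/ler_addgt0Pr => e e0.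
(* [L] adds the sup-norm Lipschitz constants of the two sides; [L + 1] below keeps the denominator
   positive. *)
pose L := \sum_i \sum_j `|A i j| + kap * n%:R.
have LA0 : 0 <= \sum_i \sum_j `|A i j| by apply: sumr_ge0 => i _; apply: sumr_ge0.
have L0 : 0 <= L by rewrite addr_ge0// mulr_ge0.
pose del := e / (L + 1).
have del0 : 0 < del by rewrite divr_gt0// ltr_wpDl.
have [v hv] := rat_dense_vec h del0.
have h1 : kap * Num.sqrt (\sum_j h j ^+ 2) <=
    kap * Num.sqrt (\sum_j (ratr (v j) : R) ^+ 2) + kap * n%:R * del.
  rewrite -mulrA -mulrDr ler_wpM2l//.
  apply: (le_trans (sqrt_sum_sqr_le h (fun j => ratr (v j)))); rewrite lerD2l.
  apply: (@le_trans _ _ (\sum_(j < n) del)); first exact: ler_sum.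
  by rewrite sumr_const card_ord mulr_natl.
have h2 : \sum_i s i * `|\sum_j A i j * ratr (v j)| <=
    \sum_i s i * `|\sum_j A i j * h j| + (\sum_i \sum_j `|A i j|) * del.
  rewrite mulr_suml -big_split/=; apply: ler_sum => i _.
  rewrite -lerBlDl -mulrBr.
  apply: (le_trans (ler_norm _)); rewrite normrM.
  apply: (@le_trans _ _ (`| `|\sum_j A i j * ratr (v j)| - `|\sum_j A i j * h j| |)).
    by rewrite ler_piMl.
  apply: (le_trans (ler_dist_dist _ _)).
  rewrite -sumrB mulr_suml; apply: (le_trans (ler_norm_sum _ _ _)).
  apply: ler_sum => j _; rewrite -mulrBr normrM ler_wpM2l// distrC.
  exact: hv.
have h3 : L * del <= e.
  rewrite /del mulrCA ler_piMr ?(ltW e0)// ler_pdivrMr ?mul1r; last by rewrite ltr_wpDl.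
  by rewrite lerDl.
apply: (le_trans h1); apply: (le_trans (lerD (H v) (lexx _))).
apply: (le_trans (lerD h2 (lexx _))); rewrite -addrA lerD2l -mulrDl.
exact: h3.
Qed.

(** * A countable dense family of unit directions *)

Section rational_directions.
Variables (n : nat) (j0 : 'I_n).

(** Enumerates the normalised rational vectors by their codes. Codes of nothing or of the zero
    vector yield the basis vector at [j0], so every index gives a unit vector. *)
Definition direction (k : nat) (j : 'I_n) : R :=
  let v := odflt [ffun=> 0] (@unpickle {ffun 'I_n -> rat} k) in
  let r := Num.sqrt (\sum_l (ratr (v l) : R) ^+ 2) in
  if r == 0 then (j == j0)%:R else ratr (v j) / r.

Lemma direction_unit (k : nat) : \sum_j direction k j ^+ 2 = 1.
Proof.
rewrite /direction; set v := odflt _ _; set r := Num.sqrt _.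
have [r0|r0] := eqVneq r 0.
  by rewrite (bigD1 j0)//= eqxx expr1n big1 ?addr0// => j /negbTE ->; rewrite expr0n.
under eq_bigr do rewrite expr_div_n.
rewrite -mulr_suml -[X in X / _]sqr_sqrtr ?divff ?expf_neq0//.
by apply: sumr_ge0 => j _; exact: sqr_ge0.
Qed.

(** Both sides are positively homogeneous, so the bound on unit directions scales to all rational
    vectors, and density does the rest. *)
Lemma signed_l1_lower_bound (m : nat) (A : 'M[R]_(m, n)) (s : 'I_m -> R) (kap : R) :
  0 <= kap -> (forall i, `|s i| <= 1) ->
  (forall k, kap <= \sum_i s i * `|\sum_j direction k j * A i j|) ->
  forall h : 'I_n -> R, kap * Num.sqrt (\sum_j h j ^+ 2) <=
     \sum_i s i * `|\sum_j A i j * h j|.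
Proof.
move=> kap0 s1 H; apply: signed_l1_rat_real => // v.
set r := Num.sqrt _.
have sv : 0 <= \sum_j (ratr (v j) : R) ^+ 2 by apply: sumr_ge0 => j _; exact: sqr_ge0.
have [r0|r0] := eqVneq r 0.
  have v0 j : ratr (v j) = 0 :> R.
    have /eqP : \sum_j (ratr (v j) : R) ^+ 2 = 0 by rewrite -[LHS]sqr_sqrtr// -/r r0 expr0n.
    rewrite psumr_eq0; last by move=> l _; exact: sqr_ge0.
    by move=> /allP/(_ j (mem_index_enum j)); rewrite sqrf_eq0 => /eqP.
  rewrite r0 mulr0 big1// => i _.
  by rewrite big1 ?normr0 ?mulr0// => j _; rewrite v0 mulr0.
have rp : 0 < r by rewrite lt_neqAle eq_sym r0 sqrtr_ge0.
have := H (pickle v); rewrite /direction pickleK/= -/r (negbTE r0).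
rewrite -(ler_pM2r rp) => /le_trans; apply.
rewrite mulr_suml; apply: ler_sum => i _; rewrite -mulrA.
rewrite -{2}(gtr0_norm rp) -normrM mulr_suml.
rewrite [X in s i * `|X|](_ : _ = \sum_j A i j * ratr (v j))//.
by apply: eq_bigr => j _; rewrite mulrAC divfK// mulrC.
Qed.

End rational_directions.

Lemma l0normE (k : nat) (v : 'cV[R]_k) : (l0norm v)%:R = \sum_i (v i 0 != 0)%:R :> R.
Proof.
rewrite /l0norm -sum1_card natr_sum big_mkcond/=; apply: eq_bigr => i _.
rewrite [_ \in _](_ : _ = (v i 0 != 0)); last exact: asboolb.
by case: (v i 0 != 0).
Qed.

(** Off the support of [z], clip <= |g_i|; on it, clip - 2t <= - |g_i|. Each corrupted row thus
    costs 2t. *)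
Lemma clip_signed_l1 (m : nat) (t eta : R) (g : 'I_m -> R) (z : 'cV[R]_m) : 0 <= t ->
  (l0norm z)%:R <= eta * m%:R ->
  \sum_i clip t (g i) - 2 * t * (eta * m%:R) <=
  \sum_i (if z i 0 != 0 then -1 else 1) * `|g i|.
Proof.
move=> t0 hz.
apply: (@le_trans _ _ (\sum_i clip t (g i) - 2 * t * (l0norm z)%:R)).
  by rewrite lerD2l lerN2 ler_wpM2l// mulr_ge0.
rewrite l0normE mulr_sumr -sumrB; apply: ler_sum => i _.
have := clip_le_norm t (g i); have := clip_le_compl t (g i).
by case: (z i 0 != 0) => /=; lra.
Qed.

(** Minimality is tested against [ws]. With g_i the entries of [A *m (wh - ws)], the difference |d_i
    + z_i| - |d_i + z_i - g_i| is at most |g_i| on the support of [z] and at most 2 |d_i| - |g_i|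
    off it. *)
Lemma l1_argmin_signed (m n : nat) (A : 'M[R]_(m, n)) (ws wh : 'cV[R]_n) (dv z : 'cV[R]_m) :
  is_l1_argmin A (A *m ws + dv + z) wh ->
  \sum_i (if z i 0 != 0 then -1 else 1) * `|\sum_j A i j * (wh - ws) j 0| <= 2 * l1norm dv.
Proof.
move=> /(_ ws); rewrite /l1norm => H.
rewrite mulr_sumr -subr_ge0 -sumrB.
apply: (@le_trans _ _ (\sum_i `|(A *m ws + dv + z - A *m ws) i 0| -
  \sum_i `|(A *m ws + dv + z - A *m wh) i 0|)); first by rewrite subr_ge0.
rewrite -sumrB; apply: ler_sum => i _.
have -> : (A *m ws + dv + z - A *m ws) i 0 = dv i 0 + z i 0.
  by rewrite !mxE; ring.
have -> : (A *m ws + dv + z - A *m wh) i 0 = dv i 0 + z i 0 - (A *m (wh - ws)) i 0.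
  by rewrite mulmxBr !mxE; ring.
have -> : \sum_j A i j * (wh - ws) j 0 = (A *m (wh - ws)) i 0 by rewrite mxE.
move: ((A *m (wh - ws)) i 0) (dv i 0) => g x.
have [->|z0] /= := eqVneq (z i 0) 0.
  rewrite addr0; have := lerB_dist g x; rewrite distrC; lra.
have := lerB_dist (x + z i 0) g; have := normr_ge0 x; lra.
Qed.

(** Subtracting 2 t eta m for the corrupted rows leaves at least t eps m, since 2 t (eta0 - eta) >=
    2 t eps. The constant 2 is that of [l1_argmin_signed], with t >= 1 in the denominator. *)
Lemma robust_of_clip_bound (m n : nat) (j0 : 'I_n) (A : 'M[R]_(m, n)) (t eps eta : R) :
  (0 < m)%N -> 1 <= t -> 0 < eps -> eta < eta0 - eps ->
  (forall k, m%:R * (2 * t * eta0 - t * eps) <=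
     \sum_i clip t (\sum_j direction j0 k j * A i j)) ->
  robust_l1_property A eta eps 2.
Proof.
move=> m0 t1 eps0 het H ws z dv hz wh hmin.
have t0 : 0 <= t by lra.
have mR : 0 < m%:R :> R by rewrite ltr0n.
pose s i : R := if z i 0 != 0 then -1 else 1.
have kap0 : 0 <= t * eps * m%:R by rewrite !mulr_ge0// ltW.
have s1 i : `|s i| <= 1 by rewrite /s; case: ifP; rewrite ?normrN normr1.
have dir k : t * eps * m%:R <= \sum_i s i * `|\sum_j direction j0 k j * A i j|.
  apply: le_trans (clip_signed_l1 (fun i => \sum_j direction j0 k j * A i j) t0 hz).
  have := H k.
  have : 0 <= (t * m%:R) * (eta0 - eps - eta) by rewrite !mulr_ge0//; lra.
  by lra.
have := signed_l1_lower_bound kap0 s1 dir (fun j => (wh - ws) j 0).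
move=> /le_trans/(_ (l1_argmin_signed hmin)) hfin.
rewrite ler_pdivlMr ?mulr_gt0//; apply: le_trans hfin.
rewrite mulrC ler_wpM2r ?sqrtr_ge0//.
by rewrite -mulrA ler_peMl// mulr_ge0// ltW.
Qed.

End deterministic.

(** * The threshold sqrt(2 ln 2) and numerical constants *)

Section constants.
Context {R : realType}.
Local Notation t := (Num.sqrt (2 * ln 2) : R).

(** This amounts to exp(1/2) <= 2, which follows from exp(-1/2) >= 1 - 1/2. *)
Lemma sqrt_2ln2_ge1 : 1 <= t.
Proof.
have h : 2^-1 <= ln (2 : R).
  rewrite -ler_expR lnK ?posrE//.
  have h := expR_ge1Dx (- 2^-1 : R); have e := expRxMexpNx_1 (2^-1 : R).
  by have := expR_gt0 (2^-1 : R); nra.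
by rewrite -[leLHS]sqrtr1 ler_wsqrtr//; lra.
Qed.

Lemma normal_pdf_sqrt_2ln2 : normal_pdf 0 1 t = normal_pdf 0 1 0 / 2.
Proof.
have ln20 : 0 <= ln (2 : R) by rewrite ln_ge0// ler1n.
rewrite !normal_pdfE ?oner_neq0// -mulrA; congr (_ * _).
rewrite /normal_fun !subr0 sqr_sqrtr; last by rewrite mulr_ge0.
rewrite expr0n oppr0 mul0r expR0 mul1r expr1n -[RHS]lnK ?posrE// lnV ?posrE//.
by congr expR; lra.
Qed.

(** The density at t is half that at 0, so the density terms cancel and only 4 t (1 - [Phi t])
    remains. *)
Lemma clip_mean_eta0 :
  2 * normal_pdf 0 1 0 - 2 * (2 * (normal_pdf 0 1 t - t * (1 - Phi t))) = 2 * t * eta0.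
Proof. by rewrite normal_pdf_sqrt_2ln2 /eta0; field. Qed.

Lemma eta0_ge0 : 0 <= eta0 :> R.
Proof.
rewrite /eta0 mulr_ge0// subr_ge0 /Phi -lee_fin fineK; last exact: fin_num_measure.
exact: probability_le1.
Qed.

(** Both sides are compared with 3/2; this turns the factor 2^(n/2) into exp(n/2). *)
Lemma sqrt2_le_expR : Num.sqrt 2 <= expR 2^-1 :> R.
Proof.
apply: le_trans (expR_ge1Dx _).
rewrite -[leRHS]ger0_norm; last by lra.
by rewrite -sqrtr_sqr ler_wsqrtr//; lra.
Qed.

End constants.

(** The bad events for finite maxima increase with k and obey one bound q by Chernoff; continuity
    from below carries q to their union, whose complement is good for all directions. *)
Lemma uniform_clip_event (d : measure_display) (T : measurableType d) (R : realType)
    (m n : nat) (P : probability T R) (W : 'I_m * 'I_n -> {RV P >-> R})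
    (u : nat -> 'I_n -> R) (eps : R) (t := Num.sqrt (2 * ln 2) : R) :
  mutual_indep W ->
  (forall p (B : set R), measurable B -> P (W p @^-1` B) = normal_prob (0 : R) 1 B) ->
  (forall k, \sum_j u k j ^+ 2 = 1) ->
  (0 < m)%N -> 0 < eps -> 16 * n%:R / eps ^+ 2 < m%:R ->
  exists E : set T, [/\ measurable E,
    forall w, E w -> forall k,
      m%:R * (2 * t * eta0 - t * eps) <= \sum_i clip t (row_dot W u i k w) &
    ((1 - expR (- (eps ^+ 2 * m%:R) / 32))%:E <= P E)%E].
Proof.
move=> iW lawW u1 m0 eps0 hm.
have t1 : 1 <= t by exact: sqrt_2ln2_ge1.
have t0 : 0 <= t by lra.
pose c := 2 * t * eta0.
have c0 : 0 <= c by rewrite /c mulr_ge0 ?eta0_ge0// mulr_ge0.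
(* This value minimises 4 lam^2 m - lam eps m, with minimum - eps^2 m / 16. *)
pose lam := eps / 8.
have lam0 : 0 < lam by rewrite divr_gt0.
pose S l w := \sum_i lam * (c - clip t (row_dot W u i l w)).
pose Y k w := maxto (fun l => S l w) k.
pose a := lam * (t * eps * m%:R).
pose q := expR (- (eps ^+ 2 * m%:R) / 32).
have mS l : measurable_fun [set: T] (S l).
  apply: measurable_sum_in => i _; apply: measurable_funM => //.
  apply: measurable_funB => //; apply: (measurableT_comp (measurable_clip t)).
  exact: (measurable_subT (measurable_row_dot (J := xpredT) _ _ _)).
have mY k : measurable_fun [set: T] (Y k) by exact: measurable_maxto.
pose bad k := [set w : T | (a < Y k w)%R].
have mbad k : measurable (bad k).
  have := mY k measurableT _ (measurable_itv `]a, +oo[).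
  rewrite setTI; congr measurable.
  by apply/seteqP; split => w /=; rewrite in_itv/= andbT.
(* The assumption on m gives n / 2 <= eps^2 m / 32, half of the available eps^2 m / 16; the other
   half is the exponent in q. Since t >= 1, the threshold a is at least lam eps m. *)
have real_le : expR (4 * lam ^+ 2 * m%:R) * Num.sqrt 2 ^+ n <= q * expR a.
  have h2 : Num.sqrt 2 ^+ n <= expR (2^-1 * n%:R) :> R.
    by rewrite expRM_natr lerXn2r ?nnegrE ?sqrtr_ge0 ?expR_ge0// sqrt2_le_expR.
  apply: (le_trans (ler_wpM2l (expR_ge0 _) h2)).
  rewrite /q -!expRD ler_expR /a /lam.
  have hn : 16 * n%:R < eps ^+ 2 * m%:R.
    by move: hm; rewrite ltr_pdivrMr ?exprn_gt0// [m%:R * _]mulrC.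
  have h3 : 0 <= eps ^+ 2 * m%:R * (t - 1).
    by apply: mulr_ge0; [apply: mulr_ge0; [exact: sqr_ge0|exact: ler0n]|rewrite subr_ge0].
  by lra.
have badq k : (P (bad k) <= q%:E)%E.
  have := @clip_mgf_bound _ _ _ _ _ _ _ iW lawW _ u1 t lam k m0 t0 (ltW lam0).
  rewrite clip_mean_eta0 => /(_ c0) mgf.
  have := le_trans (chernoff_bound P a (mY k)) mgf.
  have Pf : P (bad k) \is a fin_num by exact: fin_num_measure.
  rewrite -/(bad k) -(fineK Pf) -EFinM !lee_fin => h.
  by rewrite -(ler_pM2r (expR_gt0 a)); exact: le_trans h real_le.
have mU : measurable (\bigcup_k bad k) by exact: bigcup_measurable.
have ndbad : {homo bad : k l / (k <= l)%N >-> (k <= l)%O}.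
  move=> k l kl; apply/subsetPset => w /= /lt_le_trans; apply.
  by apply: maxto_le => j jk; apply: (@maxto_ge _ (fun l => S l w)); exact: leq_trans kl.
have PU : (P (\bigcup_k bad k) <= q%:E)%E.
  have cv := @nondecreasing_cvg_mu _ _ _ P _ mbad mU ndbad.
  rewrite -(cvg_lim _ cv)//; apply: lime_le; first exact: cvgP cv.
  by apply: nearW => k; exact: badq.
exists (~` \bigcup_k bad k); split.
- exact: measurableC.
- move=> w Ew k; have : ~ bad k w by move=> bk; apply: Ew; exists k.
  move=> /negP; rewrite -leNgt => Ya.
  have := le_trans (maxto_ge (fun l => S l w) (leqnn k)) Ya.
  rewrite /S -mulr_sumr /a ler_pM2l// sumrB sumr_const card_ord -mulr_natr /c.
  by lra.
- by rewrite probability_setC// EFinB leeB.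
Qed.

Theorem theorem1p2 :
  exists (C K N : nat), (0 < C)%N /\ (0 < K)%N /\ (0 < N)%N /\
  forall (R : realType) (eps eta : R) (m n : nat),
    0 < eps -> eta < eta0 - eps ->
    C%:R * n%:R / eps ^+ 2 < m%:R ->
    forall (d : measure_display) (T : measurableType d) (P : probability T R)
           (X : 'I_m -> 'I_n -> {RV P >-> R}),
      @iid_std_normal_matrix d T R P m n X ->
      exists E : set T,
        measurable E /\
        E `<=` [set t | robust_l1_property (\matrix_(i, j) X i j t) eta eps K%:R] /\
        ((1 - expR (- (eps ^+ 2 * m%:R) / N%:R))%:E <= P E)%E.
Proof.
(* 16 and 32 come from [uniform_clip_event], 2 from [robust_of_clip_bound]. *)
exists 16%N, 2%N, 32%N; do 3 split=> //.
move=> R eps eta m n eps0 het hm d T P X [lawX indX].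
have m0 : (0 < m)%N.
  rewrite -(ltr0n R); apply: le_lt_trans hm.
  by apply: divr_ge0; [exact: mulr_ge0|exact: sqr_ge0].
(* For n = 0 there is no index [j0] for the directions, but the error vector is empty and the whole
   space serves as [E]. *)
have [n0|n0] := posnP n.
  exists setT; split; first exact: measurableT.
  split; last by rewrite probability_setT lee_fin lerBlDr lerDl expR_ge0.
  move=> w _ ws z dv _ wh _; subst n.
  rewrite /l2norm big_ord0 sqrtr0 divr_ge0 ?mulr_ge0// ?(ltW eps0)//.
  by apply: sumr_ge0.
pose W (p : 'I_m * 'I_n) := X p.1 p.2.
have iW : mutual_indep W.
  move=> B mB; rewrite (_ : [set t | _] = [set t | forall i j, B (i, j) (X i j t)]).
    rewrite (indX (fun i j => B (i, j)))// pair_bigA/=.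
    by apply: eq_bigr => -[i j].
  by apply/seteqP; split => w /= H; [move=> i j; exact: (H (i, j))|move=> [i j]; exact: H].
have lawW p (B : set R) : measurable B -> P (W p @^-1` B) = normal_prob (0 : R) 1 B.
  exact: lawX.
pose j0 := Ordinal n0.
have [E [mE subE PE]] := uniform_clip_event iW lawW (direction_unit j0) m0 eps0 hm.
exists E; split=> //; split=> // w Ew /=.
have bound k : m%:R * (2 * Num.sqrt (2 * ln 2) * eta0 - Num.sqrt (2 * ln 2) * eps) <=
    \sum_i clip (Num.sqrt (2 * ln 2))
      (\sum_j direction j0 k j * (\matrix_(i, j) X i j w) i j).
  have := subE w Ew k; congr (_ <= _); apply: eq_bigr => i _.
  by congr (clip _ _); apply: eq_bigr => j _; rewrite mxE.
exact: (robust_of_clip_bound m0 sqrt_2ln2_ge1 eps0 het bound).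
Qed.
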